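(* Let $(M,\eta)$ be a contact manifold of dimension at least $3$ carrying an almost contact metric structure $(\phi,\xi,\eta,g)$ (with the same $1$-form $\eta$) of Chinea–Gonzalez class $C_9\oplus C_{10}$. Then $\dim M=4n+1$ for some integer $n\geq 1$. If, moreover, there exist $p\in M$ and $c\in\mathbb{R}$ such that the sectional curvature of $g$ satisfies $K_p(\pi)=c$ for each $2$-plane $\pi$ of $D_p$, where $D=\ker\eta$, then $\dim M=5$.
   Context: A contact manifold $(M,\eta)$ is a smooth manifold of odd dimension $2m+1$ with a $1$-form $\eta$ such that $\eta\wedge(d\eta)^m\neq 0$ everywhere. Its contact distribution is $D=\ker\eta\subset TM$, with fiber $D_p$ at $p$. An almost contact metric structure $(\phi,\xi,\eta,g)$ on $M$ consists of a $(1,1)$-tensor field $\phi$, a vector field $\xi$, a $1$-form $\eta$ and a Riemannian metric $g$ with $\phi^2=-I+\eta\otimes\xi$, $\eta(\xi)=1$ and $g(\phi X,\phi Y)=g(X,Y)-\eta(X)\eta(Y)$ for all $X,Y$. It is not assumed that $d\eta(X,Y)=g(X,\phi Y)$. Chinea–Gonzalez classes $C_9$, $C_{10}$: let $\nabla$ be the Levi-Civita connection of $g$ and $\Phi(X,Y)=g(X,\phi Y)$. At each point $p$, let $\mathcal{C}_p$ be the space of trilinear forms $\alpha$ on $T_pM$ satisfying $$\alpha(x,y,z)=-\alpha(x,z,y)=-\alpha(x,\phi y,\phi z)+\eta(y)\alpha(x,\xi,z)+\eta(z)\alpha(x,y,\xi).$$ The form $(x,y,z)\mapsto(\nabla_x\Phi)(y,z)$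 always belongs to $\mathcal{C}_p$. Define the subspaces $$C_9=\{\alpha\in\mathcal{C}_p:\ \alpha(x,y,z)=\eta(z)\alpha(y,x,\xi)+\eta(y)\alpha(\phi x,\phi z,\xi)\ \text{for all } x,y,z\},$$ $$C_{10}=\{\alpha\in\mathcal{C}_p:\ \alpha(x,y,z)=-\eta(z)\alpha(y,x,\xi)+\eta(y)\alpha(\phi x,\phi z,\xi)\ \text{for all } x,y,z\}.$$ The structure is of class $C_9\oplus C_{10}$ if at every point $p$ the form $(\nabla\Phi)_p$ lies in the subspace $C_9\oplus C_{10}$ of $\mathcal{C}_p$. *)

(* Defs.v *)
From HB Require Import structures.
From mathcomp Require Import all_boot all_order all_algebra all_fingroup.
From mathcomp Require Import all_classical all_reals all_analysis.
From mathcomp Require Import ring.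

Set Implicit Arguments.
Unset Strict Implicit.
Unset Printing Implicit Defensive.

Import Order.TTheory GRing.Theory Num.Theory.
Import numFieldNormedType.Exports.

Local Open Scope classical_set_scope.
Local Open Scope ring_scope.

(* Tensor calculus on a smooth manifold is done in charts: a tensor field is a
   family of smooth component maps, one for each chart, related by the
   Jacobians of the coordinate changes.  In the chart i, the tangent space at
   the point of coordinates x is 'rV[R]_n; vectors are rows, covectors are
   columns, and matrices act on rows from the right, as the library's 'J does. *)

Section Smooth.
Context {R : realType} {V W : normedModType R}.

Fixpoint class_C (k : nat) (U : set V) (f : V -> W) : Prop :=
  if k is k'.+1 then
    (forall x, U x -> differentiable f x) /\
    (forall v, class_C k' U (fun x => 'D_v f x))
  else forall x, U x -> {for x, continuous f}.

Definition smooth_on (U : set V) (f : V -> W) := forall k, class_C k U f.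

End Smooth.

(* An atlas need not be maximal: tensor fields given in the charts of an atlas
   extend uniquely to the maximal atlas containing it.  Manifolds are nonempty,
   otherwise their dimension would not be determined. *)
Record smooth_manifold (R : realType) (n : nat) := SmoothManifold {
  mfd_space :> topologicalType ;
  mfd_hausdorff : hausdorff_space mfd_space ;
  mfd_second_countable : @second_countable mfd_space ;
  mfd_nonempty : [set: mfd_space] !=set0 ;
  chart_index : Type ;
  chart_dom : chart_index -> set mfd_space ;
  chart : chart_index -> mfd_space -> 'rV[R]_n ;
  chart_inv : chart_index -> 'rV[R]_n -> mfd_space ;
  chart_dom_open : forall i, open (chart_dom i) ;
  chart_img_open : forall i, open (chart i @` chart_dom i) ;
  chartK : forall i p, chart_dom i p -> chart_inv i (chart i p) = p ;
  chart_continuous : forall i, {within chart_dom i, continuous (chart i)} ;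
  chart_inv_continuous :
    forall i, {within chart i @` chart_dom i, continuous (chart_inv i)} ;
  chart_cover : forall p, exists i, chart_dom i p ;
  chart_smooth : forall i j,
    smooth_on (chart i @` (chart_dom i `&` chart_dom j))
              (chart j \o chart_inv i)
}.

Section Tensors.
Context {R : realType} {n : nat} (M : smooth_manifold R n).
Implicit Types i j : chart_index M.

Definition chart_img i : set 'rV[R]_n := chart i @` chart_dom i.

Definition overlap i j : set 'rV[R]_n :=
  chart i @` (chart_dom i `&` chart_dom j).

Definition transition i j : 'rV[R]_n -> 'rV[R]_n := chart j \o chart_inv i.

Record vector_field := VectorField {
  vf_comp :> chart_index M -> 'rV[R]_n -> 'rV[R]_n ;
  vf_smooth : forall i, smooth_on (chart_img i) (vf_comp i) ;
  vf_change : forall i j x, overlap i j x ->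
    vf_comp j (transition i j x) = vf_comp i x *m 'J (transition i j) x
}.

Record one_form := OneForm {
  of_comp :> chart_index M -> 'rV[R]_n -> 'cV[R]_n ;
  of_smooth : forall i, smooth_on (chart_img i) (of_comp i) ;
  of_change : forall i j x, overlap i j x ->
    of_comp i x = 'J (transition i j) x *m of_comp j (transition i j x)
}.

(* (1,1)-tensor fields *)
Record endo_field := EndoField {
  ef_comp :> chart_index M -> 'rV[R]_n -> 'M[R]_n ;
  ef_smooth : forall i, smooth_on (chart_img i) (ef_comp i) ;
  ef_change : forall i j x, overlap i j x ->
    'J (transition i j) x *m ef_comp j (transition i j x)
    = ef_comp i x *m 'J (transition i j) x
}.

Record riemannian_metric := RiemannianMetric {
  rm_comp :> chart_index M -> 'rV[R]_n -> 'M[R]_n ;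
  rm_smooth : forall i, smooth_on (chart_img i) (rm_comp i) ;
  rm_change : forall i j x, overlap i j x ->
    rm_comp i x = 'J (transition i j) x *m rm_comp j (transition i j x)
                  *m ('J (transition i j) x)^T ;
  rm_sym : forall i x, chart_img i x -> (rm_comp i x)^T = rm_comp i x ;
  rm_pos : forall i x, chart_img i x -> forall u : 'rV[R]_n, u != 0 ->
    0 < (u *m rm_comp i x *m u^T) 0 0
}.

End Tensors.

Section Local.
Context {R : realType} {n : nat}.
Local Notation V := 'rV[R]_n.
Implicit Types (eta : V -> 'cV[R]_n) (g phi : V -> 'M[R]_n) (X Y Z : V -> V).

Definition pairing (a : 'cV[R]_n) (u : V) : R := (u *m a) 0 0.

Definition inner (G : 'M[R]_n) (u v : V) : R := (u *m G *m v^T) 0 0.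

Definition bracket X Y : V -> V := fun x => 'D_(X x) Y x - 'D_(Y x) X x.

(* As for all tensors below, the value at a point on tangent vectors is
   obtained from vector fields extending them, here the constant ones. *)
Definition ext_d_field eta X Y : V -> R := fun x =>
  'D_(X x) (fun y => pairing (eta y) (Y y)) x
  - 'D_(Y x) (fun y => pairing (eta y) (X y)) x
  - pairing (eta x) (bracket X Y x).

Definition ext_d eta (x u v : V) : R := ext_d_field eta (cst u) (cst v) x.

(* The covector D_u g(v,-) + D_v g(u,-) - D_- g(u,v), as a row. *)
Definition koszul g (x u v : V) : V :=
  \row_(d < n) (let e : V := delta_mx 0 d in
      'D_u (fun y => inner (g y) v e) x
    + 'D_v (fun y => inner (g y) u e) x
    - 'D_e (fun y => inner (g y) u v) x).

(* The vector with components u^a v^b Gamma_{ab}^c. *)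
Definition christoffel g (x u v : V) : V :=
  2^-1 *: koszul g x u v *m invmx (g x).

(* The Levi-Civita connection, on vector fields over the image of a chart; see
   nabla_torsion_free and nabla_metric below. *)
Definition nabla g X Y : V -> V := fun x =>
  'D_(X x) Y x + christoffel g x (X x) (Y x).

Definition curv_field g X Y Z : V -> V := fun x =>
  nabla g X (nabla g Y Z) x - nabla g Y (nabla g X Z) x
  - nabla g (bracket X Y) Z x.

Definition curv g (x u v w : V) : V := curv_field g (cst u) (cst v) (cst w) x.

Definition sectional g (x u v : V) : R :=
  inner (g x) (curv g x u v v) u
  / (inner (g x) u u * inner (g x) v v - inner (g x) u v ^+ 2).

Definition fundamental_form g phi (x u v : V) : R :=
  inner (g x) u (v *m phi x).

Definition nabla_Phi_field g phi X Y Z : V -> R := fun x =>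
  'D_(X x) (fun y => fundamental_form g phi y (Y y) (Z y)) x
  - fundamental_form g phi x (nabla g X Y x) (Z x)
  - fundamental_form g phi x (Y x) (nabla g X Z x).

Definition nabla_Phi g phi (x u v w : V) : R :=
  nabla_Phi_field g phi (cst u) (cst v) (cst w) x.

Definition kform (k : nat) := ('I_k -> V) -> R.

Definition wedge k l (a : kform k) (b : kform l) : kform (k + l) := fun w =>
  (k`! * l`!)%:R^-1 * \sum_(s : 'S_(k + l))
    (-1) ^+ s * a (fun i => w (s (lshift l i)))
              * b (fun j => w (s (rshift k j))).

Fixpoint wedge_pow (b : kform 2) (m : nat) : kform m.*2 :=
  match m return kform m.*2 with
  | 0 => fun _ => 1
  | m'.+1 => wedge b (@wedge_pow b m')
  end.

Definition one_kform (a : 'cV[R]_n) : kform 1 := fun w => pairing a (w 0).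

Definition two_kform (b : V -> V -> R) : kform 2 := fun w => b (w 0) (w 1).

(* alpha ranges over trilinear forms on a tangent space, with phi, xi, eta the
   values of the structure tensors there. *)
Section Pointwise.
Variables (phi : 'M[R]_n) (xi : V) (eta : 'cV[R]_n).
Implicit Type alpha : V -> V -> V -> R.

Definition trilinear alpha :=
  [/\ forall v w, scalar (fun u => alpha u v w),
      forall u w, scalar (fun v => alpha u v w) &
      forall u v, scalar (alpha u v)].

Definition in_C alpha := trilinear alpha /\
  forall x y z,
    alpha x y z = - alpha x z y /\
    alpha x y z = - alpha x (y *m phi) (z *m phi)
                  + pairing eta y * alpha x xi z
                  + pairing eta z * alpha x y xi.

Definition in_C9 alpha := in_C alpha /\
  forall x y z,
    alpha x y z = pairing eta z * alpha y x xi
                  + pairing eta y * alpha (x *m phi) (z *m phi) xi.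

Definition in_C10 alpha := in_C alpha /\
  forall x y z,
    alpha x y z = - (pairing eta z * alpha y x xi)
                  + pairing eta y * alpha (x *m phi) (z *m phi) xi.

Definition in_C9_C10 alpha :=
  exists a9 a10, [/\ in_C9 a9, in_C10 a10 &
    forall x y z, alpha x y z = a9 x y z + a10 x y z].

(* The sum is direct. *)
Lemma C9_C10_direct alpha : pairing eta xi = 1 ->
  in_C9 alpha -> in_C10 alpha -> forall x y z, alpha x y z = 0.
Proof.
move=> exi [_ h9] [_ h10].
have h0 x y : alpha y x xi = 0.
  have := h9 x y xi; rewrite h10 exi !mul1r => /addIr/eqP.
  by rewrite -subr_eq0 -opprD oppr_eq0 -mulr2n mulrn_eq0 /= => /eqP.
by move=> x y z; rewrite h9 !h0 !mulr0 addr0.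
Qed.

End Pointwise.

Lemma innerE (G : 'M[R]_n) u v :
  inner G u v = \sum_a \sum_b (u 0 a * v 0 b) * G a b.
Proof.
rewrite /inner mxE exchange_big; apply: eq_bigr => b _.
rewrite !mxE mulr_suml; apply: eq_bigr => a _.
by rewrite mulrAC.
Qed.

Lemma inner_sym (G : 'M[R]_n) u v : G^T = G -> inner G u v = inner G v u.
Proof.
move=> Gs; rewrite !innerE exchange_big; apply: eq_bigr => b _.
apply: eq_bigr => a _; rewrite [u 0 a * _]mulrC; congr (_ * _).
by rewrite -[in LHS]Gs mxE.
Qed.

Lemma differentiable_inner g x u v :
  differentiable g x -> differentiable (fun y => inner (g y) u v) x.
Proof.
move=> dg.
have -> : (fun y => inner (g y) u v) =
    \sum_a \sum_b (u 0 a * v 0 b) *: (fun y => g y a b).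
  apply/funext => y; rewrite innerE fct_sumE; apply: eq_bigr => a _.
  by rewrite fct_sumE.
apply: differentiable_sum => a; apply: differentiable_sum => b.
apply: differentiableZ.
exact: (differentiable_comp dg (differentiable_coord _ _ _)).
Qed.

Lemma inner_sumr G u w :
  inner G u w = \sum_d w 0 d * inner G u (delta_mx 0 d).
Proof.
rewrite /inner [in LHS](row_sum_delta w) linear_sum /= mulmx_sumr summxE.
by apply: eq_bigr => d _; rewrite linearZ /= -scalemxAr mxE.
Qed.

Lemma derive_inner_sumr g x u v w : differentiable g x ->
  'D_u (fun y => inner (g y) v w) x =
  \sum_d w 0 d * 'D_u (fun y => inner (g y) v (delta_mx 0 d)) x.
Proof.
move=> dg.
have -> : (fun y => inner (g y) v w) =
    \sum_d w 0 d *: (fun y => inner (g y) v (delta_mx 0 d)).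
  by apply/funext => y; rewrite inner_sumr fct_sumE.
have dd d : derivable (fun y => inner (g y) v (delta_mx 0 d)) x u.
  exact/diff_derivable/differentiable_inner.
rewrite derive_sum; last by move=> d; exact: derivableZ.
by apply: eq_bigr => d _; rewrite deriveZ.
Qed.

Lemma derive_sumr (f : V -> R) x w : differentiable f x ->
  'D_w f x = \sum_d w 0 d * 'D_(delta_mx 0 d) f x.
Proof.
move=> df; rewrite deriveE // [in LHS](row_sum_delta w) linear_sum.
by apply: eq_bigr => d _; rewrite linearZ /= deriveE.
Qed.

Lemma inner_christoffel g x u v w : g x \in unitmx -> differentiable g x ->
  2 * inner (g x) (christoffel g x u v) w =
    'D_u (fun y => inner (g y) v w) x + 'D_v (fun y => inner (g y) u w) x
    - 'D_w (fun y => inner (g y) u v) x.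
Proof.
move=> gu dg; rewrite /christoffel /inner mulmxKV // -scalemxAl mxE mulrA.
rewrite divff ?mul1r ?pnatr_eq0 // mxE.
rewrite [in RHS](derive_inner_sumr _ v w dg) (derive_inner_sumr _ u w dg).
rewrite (derive_sumr w (differentiable_inner u v dg)).
rewrite -big_split -sumrB /=; apply: eq_bigr => d _.
by rewrite !mxE /=; ring.
Qed.

Lemma nabla_cst g x u v : nabla g (cst u) (cst v) x = christoffel g x u v.
Proof. by rewrite /nabla derive_cst add0r. Qed.

End Local.

Arguments wedge_pow {R n} b m _.

Section LeviCivita.
Context {R : realType} {n : nat} {M : smooth_manifold R n}.
Variables (g : riemannian_metric M) (i : chart_index M).

Lemma riemannian_metric_unit x : chart_img i x -> g i x \in unitmx.
Proof.
move=> ix; rewrite -row_free_unit -kermx_eq0; apply/negPn/negP.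
case/rowV0Pn => u /sub_kermxP ug u0.
by have := rm_pos g ix u0; rewrite ug mul0mx mxE ltxx.
Qed.

(* Together with the Leibniz rule built into nabla, the next two lemmas
   characterize the Levi-Civita connection. *)
Lemma nabla_torsion_free x X Y : chart_img i x ->
  nabla (g i) X Y x - nabla (g i) Y X x = bracket X Y x.
Proof.
move=> ix; suff ks : koszul (g i) x (X x) (Y x) = koszul (g i) x (Y x) (X x).
  by rewrite /nabla /christoffel ks opprD addrACA subrr addr0.
apply/rowP => d; rewrite !mxE /=; congr (_ - _); first exact: addrC.
apply: near_eq_derive; near=> y; apply: inner_sym; apply: rm_sym.
by near: y; apply: open_nbhs_nbhs; split => //; exact: chart_img_open.
Unshelve. all: by end_near. Qed.

Lemma nabla_metric x w u v : chart_img i x ->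
  'D_w (fun y => inner (g i y) u v) x =
  inner (g i x) (nabla (g i) (cst w) (cst u) x) v
  + inner (g i x) u (nabla (g i) (cst w) (cst v) x).
Proof.
move=> ix; have gu := riemannian_metric_unit ix.
have dg : differentiable (g i) x by case: (rm_smooth g i 1) => + _; exact.
have sg a b : 'D_w (fun y => inner (g i y) a b) x =
              'D_w (fun y => inner (g i y) b a) x.
  apply: near_eq_derive; near=> y; apply: inner_sym; apply: rm_sym.
  by near: y; apply: open_nbhs_nbhs; split => //; exact: chart_img_open.
apply: (mulfI (_ : 2 != 0 :> R)); first by rewrite pnatr_eq0.
rewrite !nabla_cst mulrDr.
rewrite (inner_sym u) ?(rm_sym g ix) // !inner_christoffel // (sg v u).
by rewrite addrACA [X in _ + _ + X]addrC; ring.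
Unshelve. all: by end_near. Qed.

End LeviCivita.

Section Structures.
Context {R : realType} {n : nat} {M : smooth_manifold R n}.

(* xi, eta and phi act on tangent vectors u by phi u = u *m phi and
   eta u = pairing eta u. *)
Record almost_contact_metric (phi : endo_field M) (xi : vector_field M)
    (eta : one_form M) (g : riemannian_metric M) : Prop := {
  acm_phi2 : forall i x, chart_img i x -> forall u : 'rV[R]_n,
    u *m phi i x *m phi i x = - u + pairing (eta i x) u *: xi i x ;
  acm_eta_xi : forall i x, chart_img i x -> pairing (eta i x) (xi i x) = 1 ;
  acm_compat : forall i x, chart_img i x -> forall u v : 'rV[R]_n,
    inner (g i x) (u *m phi i x) (v *m phi i x)
    = inner (g i x) u v - pairing (eta i x) u * pairing (eta i x) v
}.

Definition class_C9_C10 (phi : endo_field M) (xi : vector_field M)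
    (eta : one_form M) (g : riemannian_metric M) : Prop :=
  forall i x, chart_img i x ->
    in_C9_C10 (phi i x) (xi i x) (eta i x) (nabla_Phi (g i) (phi i) x).

(* Every 2-plane of D_p = ker eta_p has sectional curvature c; a 2-plane is
   given by a basis (u, v). *)
Definition constant_curvature_on_ker (eta : one_form M)
    (g : riemannian_metric M) (p : M) (c : R) : Prop :=
  forall i, chart_dom i p -> forall u v : 'rV[R]_n,
    pairing (eta i (chart i p)) u = 0 -> pairing (eta i (chart i p)) v = 0 ->
    row_free (col_mx u v) ->
    sectional (g i) (chart i p) u v = c.

End Structures.

Definition contact_form (R : realType) (m : nat)
    (M : smooth_manifold R m.*2.+1) (eta : one_form M) : Prop :=
  forall i x, chart_img i x ->
    exists w : 'I_(1 + m.*2) -> 'rV[R]_m.*2.+1,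
      wedge (one_kform (eta i x)) (wedge_pow (two_kform (ext_d (eta i) x)) m) w
      != 0.

(* Main.v *)
(* Write b(x, y) for (nabla_x Phi)(y, xi).  In the class C9 + C10 the tensor
   nabla Phi is determined by b, which is anti-invariant under phi, and
   (nabla_x eta)(y) = - b(x, phi y), so that d eta(x, phi y) is, up to sign,
   the skew part A(x, y) = b(x, y) - b(y, x).  The contact condition makes A
   nondegenerate on D = ker eta.  Since A(phi x, phi y) = - A(x, y), over the
   complex numbers A pairs each eigenspace of phi with itself, and skew forms
   have even rank: 4 divides the dimension of D.

   The Ricci identity for Phi, restricted to D, involves no derivative of b:
   if R is the curvature,
     Phi(R(x, y)z, w) + Phi(z, R(x, y)w)
       = b(x, phi w) b(y, z) - b(x, phi z) b(y, w) - (x <-> y).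
   With R of constant curvature c on D this reads F(Bx, By) = c F(x, y), where
   b(x, y) = g(Bx, y) and F(x, y) = phi x ^ y + x ^ phi y.  As F is complex
   bilinear and B antilinear, c F = 0, whence c = 0 and B has complex rank at
   most 1.  So b has rank at most 2 and A rank at most 4 = dim D. *)

Require Import Defs.
From HB Require Import structures.
From mathcomp Require Import all_boot all_order all_algebra all_fingroup.
From mathcomp Require Import complex.
From mathcomp Require Import all_classical all_reals all_analysis.
From mathcomp Require Import ring lra.

Set Implicit Arguments.
Unset Strict Implicit.
Unset Printing Implicit Defensive.

Import Order.TTheory GRing.Theory Num.Theory.
Import numFieldNormedType.Exports.

Local Open Scope classical_set_scope.
Local Open Scope ring_scope.

(** * Skew matrices and curvature tensors *)

(** Compressing [A] by a right inverse [K] of its row base gives an invertible skew matrix [S] whose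
    size is the rank of [A]; an odd size would force det S = - det S, hence det S = 0. *)
Lemma mxrank_skew_even (F : fieldType) n (A : 'M[F]_n) :
  2 != 0 :> F -> A^T = - A -> ~~ odd (\rank A).
Proof.
move=> F2 As.
suff skew_unit r (C : 'M[F]_(n, r)) (B : 'M[F]_(r, n)) (K : 'M[F]_(n, r)) :
    A = C *m B -> B *m K = 1%:M -> (r <= \rank A)%N -> ~~ odd r.
  apply: (skew_unit _ (col_base A) (row_base A) (pinvmx (row_base A))) => //.
    by rewrite mulmx_base.
  by rewrite mulmxVp // row_base_free.
move=> ACB BK rA.
have AKB : A *m (K *m B) = A by rewrite ACB -mulmxA (mulmxA B) BK mul1mx.
pose S := K^T *m A *m K.
have SA : B^T *m S *m B = A.
  have -> : B^T *m S *m B = (K *m B)^T *m (A *m (K *m B)).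
    by rewrite /S trmx_mul !mulmxA.
  by rewrite AKB -[LHS]trmxK trmx_mul trmxK As mulNmx AKB -As trmxK.
have ST : S^T = - S by rewrite /S !trmx_mul trmxK As mulNmx mulmxN mulmxA.
have Su : S \in unitmx.
  rewrite -row_free_unit /row_free eqn_leq rank_leq_row (leq_trans rA) //.
  by rewrite -SA (leq_trans (mxrankM_maxl _ _)) // mxrankM_maxr.
move: Su; rewrite unitmxE unitfE; apply: contra => rodd.
have : \det S = - \det S.
  by rewrite -[in LHS]det_tr ST -scaleN1r detZ -signr_odd rodd expr1 mulN1r.
by move/eqP; rewrite -addr_eq0 -mulr2n -mulr_natl mulf_eq0 (negPf F2).
Qed.

(* The projections P and Q onto the two eigenspaces of J split A into the
   conjugate skew matrices P A and Q A of equal, even, ranks. *)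
Lemma mxrank_skew_anticommuting (F : fieldType) (conj : {rmorphism F -> F})
    (i : F) n (A J : 'M[F]_n) :
  2 != 0 :> F -> i ^+ 2 = -1 -> conj i = - i ->
  map_mx conj A = A -> map_mx conj J = J ->
  A^T = - A -> J *m J *m J = - J -> J *m A *m J^T = - A ->
  J *m J *m A = - A -> (4 %| \rank A)%N.
Proof.
move=> F2 i2 ic Ac Jc As J3 JAJ JJA.
have i2' : i * i = -1 by rewrite -expr2.
have JA : J *m A = A *m J^T.
  have := congr1 (mulmx J) JAJ; rewrite mulmxN !mulmxA JJA mulNmx.
  by move/oppr_inj ->.
(* On row eigenvectors of [J] for [i], [- i] and 0, [P] acts as 1, 0, 0 and [Q] as 0, 1, 0. *)
pose P := 2^-1 *: (- (J *m J) - i *: J).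
pose Q := 2^-1 *: (- (J *m J) + i *: J).
have c2 : conj 2^-1 = 2^-1 by rewrite fmorphV rmorph_nat.
have Pc : map_mx conj P = Q.
  rewrite /P map_mxZ map_mxD !map_mxN map_mxM map_mxZ Jc c2 /= ic.
  by rewrite scaleNr opprK.
have PQ : P + Q = - (J *m J).
  rewrite /P /Q -scalerDr addrACA addNr addr0 -mulr2n -scaler_nat scalerA.
  by rewrite mulVf // scale1r.
have J4 : J *m J *m (J *m J) = - (J *m J) by rewrite mulmxA J3 mulNmx.
pose T := i *: J.
have TT : T *m T = - (J *m J).
  by rewrite /T -scalemxAl -scalemxAr scalerA i2' scaleN1r.
have JT : J *m J *m T = - T by rewrite /T -scalemxAr J3 scalerN.
have TJ : T *m (J *m J) = - T by rewrite /T -scalemxAl mulmxA J3 scalerN.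
have QP0 : Q *m P = 0.
  rewrite /P /Q -/T -scalemxAl -scalemxAr.
  rewrite !(mulmxDl, mulmxDr, mulmxN, mulNmx) J4 JT TJ TT !opprK addrA subrK.
  by rewrite addNr !scaler0.
have PQ0 : P *m Q = 0.
  rewrite /P /Q -/T -scalemxAl -scalemxAr.
  rewrite !(mulmxDl, mulmxDr, mulmxN, mulNmx) J4 JT TJ TT !opprK addrA.
  by rewrite addrK addNr !scaler0.
have JJA' : J *m J *m A = A *m (J^T *m J^T) by rewrite -mulmxA JA !mulmxA JA.
have PA : P *m A = A *m P^T.
  have -> : P^T = 2^-1 *: (- (J^T *m J^T) - i *: J^T).
    by rewrite /P linearZ /= linearB /= linearN /= linearZ /= trmx_mul.
  rewrite /P -scalemxAl -scalemxAr mulmxBl mulmxBr mulmxN mulNmx JJA'.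
  by rewrite -scalemxAl -scalemxAr JA.
have QA : Q *m A = A *m Q^T.
  have -> : Q^T = 2^-1 *: (- (J^T *m J^T) + i *: J^T).
    by rewrite /Q linearZ /= linearD /= linearN /= linearZ /= trmx_mul.
  rewrite /Q -scalemxAl -scalemxAr mulmxDl mulmxDr mulmxN mulNmx JJA'.
  by rewrite -scalemxAl -scalemxAr JA.
have PTJ : P^T *m (J^T *m J^T) = - P^T.
  rewrite -!trmx_mul -linearN; congr trmx.
  by rewrite /P -/T -scalemxAr mulmxBr mulmxN J4 JT -[RHS]scalerN opprD !opprK.
have APQ : P *m A + Q *m A = A by rewrite -mulmxDl PQ mulNmx JJA opprK.
have rPQ : \rank (P *m A) = \rank (Q *m A).
  by rewrite -(mxrank_map conj (P *m A)) map_mxM Pc Ac.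
have skewP : (P *m A)^T = - (P *m A).
  by rewrite trmx_mul As mulNmx PA.
have rP := mxrank_skew_even F2 skewP.
have rA : \rank A = (\rank (P *m A) + \rank (Q *m A))%N.
  apply/eqP; rewrite eqn_leq; apply/andP; split.
    by rewrite -[X in (\rank X <= _)%N]APQ mxrank_add.
  (* Since [P *m A = A *m P^T], the rows of [P *m A] are killed by [Q^T], and likewise those of
     [Q *m A] by [P^T]. A common vector is killed by [(P + Q)^T], which also fixes it. *)
  have cap0 : (P *m A :&: Q *m A = 0)%MS.
    apply/eqP/rowV0P => v; rewrite sub_capmx => /andP[/submxP[a va] /submxP[b vb]].
    have e1 : v *m Q^T = 0.
      by rewrite va PA -!mulmxA -trmx_mul QP0 trmx0 !mulmx0.
    have e2 : v *m P^T = 0.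
      by rewrite vb QA -!mulmxA -trmx_mul PQ0 trmx0 !mulmx0.
    have e3 : v *m (P + Q)^T = v.
      rewrite PQ linearN /= trmx_mul mulmxN va PA -!mulmxA.
      by rewrite PTJ !mulmxN opprK.
    by rewrite -e3 linearD mulmxDr e1 e2 addr0.
  rewrite -(mxrank_disjoint_sum cap0) mxrankS // addsmx_sub.
  by rewrite !submxMl.
by rewrite rA -rPQ addnn -mul2n (@dvdn_pmul2l 2 2) // dvdn2.
Qed.

(** The rank does not change when scalars are extended to [R[i]], where the eigenvalues of [J] and a
    conjugation are available. *)
Lemma mxrank_skew_anticommuting_real (R : rcfType) n (A J : 'M[R]_n) :
  A^T = - A -> J *m J *m J = - J -> J *m A *m J^T = - A ->
  J *m J *m A = - A -> (4 %| \rank A)%N.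
Proof.
move=> As J3 JAJ JJA.
pose c : {rmorphism R -> R[i]} := real_complex R.
have cc m p (B : 'M[R]_(m, p)) :
    map_mx (@conjc R) (map_mx c B) = map_mx c B.
  by apply/matrixP => a b; rewrite !mxE /= oppr0.
rewrite -(mxrank_map c).
apply: (@mxrank_skew_anticommuting _ (@conjc R) 'i%C _ _ (map_mx c J)) => //.
- by rewrite sqr_i.
- by apply/eqP; rewrite eq_complex /= oppr0 !eqxx.
- by rewrite map_trmx As map_mxN.
- by rewrite -!map_mxM J3 map_mxN.
- by rewrite map_trmx -!map_mxM JAJ map_mxN.
- by rewrite -!map_mxM JJA map_mxN.
Qed.

(** The matrix [row_mx A a] has no left kernel, so its rank is [n], and its last column contributes
    at most 1. *)
Lemma mxrank_ker_cV (F : fieldType) n (A : 'M[F]_n) (a : 'cV[F]_n) :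
  (forall u : 'rV_n, u *m A = 0 -> u *m a = 0 -> u = 0) ->
  (n <= (\rank A).+1)%N.
Proof.
move=> inj.
have rf : row_free (row_mx A a).
  rewrite -kermx_eq0; apply/rowV0P => v /sub_kermxP; rewrite mul_mx_row.
  by rewrite -(row_mx0 _ _ _ 1) => /eq_row_mx[]; exact: inj.
rewrite -[X in (X <= _)%N](eqP rf) -mxrank_tr tr_row_mx -addsmxE.
rewrite (leq_trans (mxrank_adds_leqif _ _)) //.
by rewrite mxrank_tr -[in leqRHS]addn1 leq_add2l rank_leq_row.
Qed.

(** Four instances of the Bianchi identity give the pair symmetry, hence additivity in every slot.
    Polarising [T u v v u = 0] in [u] and then in [v] makes [T] skew in its two middle arguments,
    and the Bianchi identity becomes 3 T = 0. *)
Lemma curvature_tensor_eq0 (R : realFieldType) (V : zmodType)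
    (T : V -> V -> V -> V -> R) :
  (forall u v z w w', T u v z (w + w') = T u v z w + T u v z w') ->
  (forall u v z w, T u v z w = - T v u z w) ->
  (forall u v z w, T u v z w = - T u v w z) ->
  (forall u v z w, T u v z w + T v z u w + T z u v w = 0) ->
  (forall u v, T u v v u = 0) -> forall u v z w, T u v z w = 0.
Proof.
move=> T4 T12 T34 bianchi T0.
have Tsym u v z w : T u v z w = T z w u v.
  have := bianchi u v z w; have := bianchi v z w u.
  have := bianchi z w u v; have := bianchi w u v z.
  rewrite (T34 u v w z) (T34 v z w u) (T12 u z w v) (T34 z u w v).
  rewrite (T34 z w v u) (T12 v w u z) (T34 w v u z) (T34 w u v z).
  by lra.
have T3 u v z z' w : T u v (z + z') w = T u v z w + T u v z' w.
  by rewrite T34 T4 opprD -!T34.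
have T1 u u' v z w : T (u + u') v z w = T u v z w + T u' v z w.
  by rewrite Tsym T3 -!(Tsym _ v).
have T2 u v v' z w : T u (v + v') z w = T u v z w + T u v' z w.
  by rewrite Tsym T4 -!(Tsym u).
have Tvv u v w : T u v v w = 0.
  have := T0 (u + w) v; rewrite T1 !T4 !T0 add0r addr0.
  by rewrite [T w v v u]Tsym T12 T34 opprK; lra.
have Tanti u v z w : T u z v w = - T u v z w.
  by have := Tvv u (v + z) w; rewrite T2 !T3 !Tvv; lra.
move=> u v z w; have := bianchi u v z w.
by rewrite [T v z u w]Tanti (T12 v u) (T12 z u) [T u z v w]Tanti; lra.
Qed.

(** A curvature tensor is determined by its values [K u v v u]: the difference from the model tensor
    satisfies the hypotheses of [curvature_tensor_eq0]. *)
Lemma constant_sectional_curvature (R : realFieldType) (V : zmodType)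
    (s : V -> V -> R) (K : V -> V -> V -> V -> R) (c : R) :
  (forall u v, s u v = s v u) ->
  (forall u v v', s u (v + v') = s u v + s u v') ->
  (forall u v z w w', K u v z (w + w') = K u v z w + K u v z w') ->
  (forall u v z w, K u v z w = - K v u z w) ->
  (forall u v z w, K u v z w = - K u v w z) ->
  (forall u v z w, K u v z w + K v z u w + K z u v w = 0) ->
  (forall u v, K u v v u = c * (s u u * s v v - s u v ^+ 2)) ->
  forall u v z w, K u v z w = c * (s v z * s u w - s u z * s v w).
Proof.
move=> sC sD K4 K12 K34 bianchi Kc u v z w; apply/eqP; rewrite -subr_eq0.
apply/eqP; move: u v z w; apply: (curvature_tensor_eq0
  (T := fun u v z w => K u v z w - c * (s v z * s u w - s u z * s v w))).
- by move=> u v z w w'; rewrite K4 !sD; ring.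
- by move=> u v z w; rewrite K12; ring.
- by move=> u v z w; rewrite K34; ring.
- move=> u v z w; rewrite -[RHS](bianchi u v z w) (sC v u) (sC z u) (sC z v).
  by ring.
- by move=> u v; rewrite Kc (sC v u); ring.
Qed.

(** * Almost contact metric structures at a point *)

Section Inner.
Context {R : realType} {n : nat}.
Implicit Types (G H : 'M[R]_n) (a : 'cV[R]_n) (u v w : 'rV[R]_n).

Lemma pairingD a u v : pairing a (u + v) = pairing a u + pairing a v.
Proof. by rewrite /pairing mulmxDl mxE. Qed.

Lemma pairingZ a c u : pairing a (c *: u) = c * pairing a u.
Proof. by rewrite /pairing -scalemxAl mxE. Qed.

Lemma pairingN a u : pairing a (- u) = - pairing a u.
Proof. by rewrite -scaleN1r pairingZ mulN1r. Qed.

Lemma innerDl G u u' v : inner G (u + u') v = inner G u v + inner G u' v.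
Proof. by rewrite /inner !mulmxDl mxE. Qed.

Lemma innerZl G c u v : inner G (c *: u) v = c * inner G u v.
Proof. by rewrite /inner -!scalemxAl mxE. Qed.

Lemma innerDr G u v v' : inner G u (v + v') = inner G u v + inner G u v'.
Proof. by rewrite /inner linearD /= mulmxDr mxE. Qed.

Lemma innerZr G c u v : inner G u (c *: v) = c * inner G u v.
Proof. by rewrite /inner linearZ /= -scalemxAr mxE. Qed.

Lemma innerNl G u v : inner G (- u) v = - inner G u v.
Proof. by rewrite -scaleN1r innerZl mulN1r. Qed.

Lemma innerNr G u v : inner G u (- v) = - inner G u v.
Proof. by rewrite -scaleN1r innerZr mulN1r. Qed.

Lemma inner0l G v : inner G 0 v = 0.
Proof. by rewrite -(scale0r 0) innerZl mul0r. Qed.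

Lemma inner0r G u : inner G u 0 = 0.
Proof. by rewrite -(scale0r 0) innerZr mul0r. Qed.

Lemma innerMr G H u v : inner G u (v *m H) = inner (G *m H^T) u v.
Proof. by rewrite /inner trmx_mul !mulmxA. Qed.

Lemma innerMl G H u v : inner G (u *m H) v = inner (H *m G) u v.
Proof. by rewrite /inner !mulmxA. Qed.

Lemma inner_tr G u v : inner G^T u v = inner G v u.
Proof.
by rewrite [RHS]/inner -[in RHS](trmxK (v *m _ *m _)) mxE !trmx_mul trmxK mulmxA.
Qed.

Lemma innerDm G H u v : inner (G + H) u v = inner G u v + inner H u v.
Proof. by rewrite /inner mulmxDr mulmxDl mxE. Qed.

Lemma innerNm G u v : inner (- G) u v = - inner G u v.
Proof. by rewrite /inner mulmxN mulNmx mxE. Qed.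

Lemma innerZm c G u v : inner (c *: G) u v = c * inner G u v.
Proof. by rewrite /inner -scalemxAr -scalemxAl mxE. Qed.

Lemma inner_rank1 a (b u v : 'rV[R]_n) :
  inner (a *m b) u v = (u *m a) 0 0 * (b *m v^T) 0 0.
Proof. by rewrite /inner !mulmxA -mulmxA [LHS]mxE big_ord1. Qed.

Lemma inner_delta G i j : inner G (delta_mx 0 i) (delta_mx 0 j) = G i j.
Proof. by rewrite /inner trmx_delta -rowE -colE !mxE. Qed.

Lemma eq_inner G H : (forall u v, inner G u v = inner H u v) -> G = H.
Proof. by move=> GH; apply/matrixP => i j; rewrite -!inner_delta. Qed.

Lemma row_free_col_mx2 u v : row_free (col_mx u v) ->
  forall c d, c *: u + d *: v = 0 -> c = 0 /\ d = 0.
Proof.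
move=> uv a b ab0.
have : row_mx a%:M b%:M *m col_mx u v = 0 *m col_mx u v.
  by rewrite mul_row_col !mul_scalar_mx mul0mx.
move/(row_free_inj uv); rewrite -(row_mx0 _ 1 1 1) => /eq_row_mx[].
by move=> /matrixP/(_ 0 0) + /matrixP/(_ 0 0); rewrite !mxE !mulr1n.
Qed.

Lemma row_free_col_mx2N u v : ~~ row_free (col_mx u v) ->
  (exists c, u = c *: v) \/ (exists c, v = c *: u).
Proof.
rewrite -kermx_eq0 => /rowV0Pn[w /sub_kermxP w0 wn0].
have : w = row_mx (w 0 (lshift 1 0))%:M (w 0 (rshift 1 0))%:M.
  rewrite -[LHS]hsubmxK; congr row_mx; apply/matrixP => a b;
  by rewrite !ord1 !mxE mulr1n.
move: (w 0 _) (w 0 _) => a b we; move: w0 wn0; rewrite we mul_row_col.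
rewrite !mul_scalar_mx row_mx_eq0 negb_and => ab0.
have scal (c d : R) (p q : 'rV[R]_n) : c *: p + d *: q = 0 -> c%:M != 0 :> 'M[R]_1 ->
    p = (- (c^-1 * d)) *: q.
  move=> e c0; have {}c0 : c != 0 by apply: contraNneq c0 => ->; rewrite raddf0.
  apply: (scalerI c0); rewrite scalerA mulrN mulrA divff // mul1r scaleNr.
  by apply/eqP; rewrite -addr_eq0 e.
case/orP => [/(scal _ _ _ _ ab0)|]; first by left; eexists; eassumption.
by rewrite addrC in ab0 => /(scal _ _ _ _ ab0); right; eexists; eassumption.
Qed.

(** Strict Cauchy-Schwarz: the vector |v|^2 u - <u, v> v is nonzero, and its squared norm is |v|^2
    times the Gram determinant. *)
Lemma gram_neq0 G u v : G^T = G -> (forall w, w != 0 -> 0 < inner G w w) ->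
  row_free (col_mx u v) -> inner G u u * inner G v v - inner G u v ^+ 2 != 0.
Proof.
move=> Gsym Gpos uv; have indep := row_free_col_mx2 uv.
have v0 : v != 0.
  apply/eqP => v0; have := indep 0 1; rewrite v0 scaler0 scale0r addr0.
  by case=> // _ /eqP; rewrite oner_eq0.
have vv := Gpos v v0.
have : inner G v v *: u + (- inner G u v) *: v != 0.
  by apply/eqP => /indep[vv0]; rewrite vv0 ltxx in vv.
move/Gpos; rewrite !(innerDl, innerDr, innerZl, innerZr) (inner_sym v u Gsym).
move=> pos; apply/eqP => gram0; move: pos.
rewrite (_ : _ + _ = inner G v v
  * (inner G u u * inner G v v - inner G u v ^+ 2)); last by ring.
by rewrite gram0 mulr0 ltxx.
Qed.

Lemma bilinear_inner (f : 'rV[R]_n -> 'rV[R]_n -> R) :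
  (forall v, scalar (f^~ v)) -> (forall u, scalar (f u)) ->
  exists B : 'M[R]_n, forall u v, f u v = inner B u v.
Proof.
move=> fl fr; exists (\matrix_(i, j) f (delta_mx 0 i) (delta_mx 0 j)) => u v.
pose fL v := GRing.isLinear.Build _ _ _ _ (f^~ v) (fl v).
pose fR u := GRing.isLinear.Build _ _ _ _ (f u) (fr u).
pose lf v : {linear 'rV[R]_n -> R^o} := HB.pack (f^~ v) (fL v).
pose rf u : {linear 'rV[R]_n -> R^o} := HB.pack (f u) (fR u).
rewrite innerE [u in LHS]row_sum_delta -[f _ v]/(lf v _) linear_sum.
apply: eq_bigr => i _; rewrite linearZ /= [v in LHS]row_sum_delta.
rewrite -[f _ _]/(rf _ _) linear_sum scaler_sumr; apply: eq_bigr => j _.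
by rewrite linearZ scalerA [in RHS]mxE.
Qed.

End Inner.

(** * The rank argument on a single tangent space *)

Section AlmostContact.
Context {R : realType} {n : nat}.
Variables (G J B : 'M[R]_n) (xi : 'rV[R]_n) (eta : 'cV[R]_n).
Hypothesis Gsym : G^T = G.
Hypothesis Gpos : forall u : 'rV[R]_n, u != 0 -> 0 < inner G u u.
Hypothesis J2 : forall u, u *m J *m J = - u + pairing eta u *: xi.
Hypothesis eta_xi : pairing eta xi = 1.
Hypothesis compat : forall u v,
  inner G (u *m J) (v *m J) = inner G u v - pairing eta u * pairing eta v.

(** The identity [J2] at xi gives xi J J = 0, and at xi J it gives xi J = t xi with t = eta(xi J).
    Applying [J] once more yields t (xi J) = 0, and either factor being zero gives the claim. *)
Lemma xi_J : xi *m J = 0.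
Proof.
have xJJ : xi *m J *m J = 0 by rewrite J2 eta_xi scale1r addNr.
have := J2 (xi *m J); rewrite xJJ mul0mx => /esym/eqP.
rewrite addrC subr_eq0 => /eqP e; apply/eqP.
have := congr1 (mulmx^~ J) e; rewrite /= xJJ -scalemxAl => /eqP.
rewrite scaler_eq0 => /orP[/eqP e0|//].
by rewrite -e e0 scale0r.
Qed.

(** Computing u J J J in two ways leaves eta(u J) xi = 0. *)
Lemma eta_J u : pairing eta (u *m J) = 0.
Proof.
have := J2 (u *m J); rewrite {1}(J2 u) mulmxDl mulNmx -scalemxAl xi_J scaler0.
move/addrI/esym => e.
have := congr1 (pairing eta) e; rewrite pairingZ eta_xi mulr1 => ->.
by rewrite /pairing mul0mx mxE.
Qed.

Lemma inner_xi u : inner G u xi = pairing eta u.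
Proof.
have := compat u xi; rewrite xi_J inner0r eta_xi mulr1 => /esym/eqP.
by rewrite subr_eq0 => /eqP.
Qed.

Lemma inner_skewJ u v : inner G u (v *m J) = - inner G (u *m J) v.
Proof.
have := compat u (v *m J); rewrite J2 eta_J mulr0 subr0 => <-.
by rewrite innerDr innerNr innerZr inner_xi eta_J mulr0 addr0.
Qed.

Lemma J_cube : J *m J *m J = - J.
Proof.
apply/row_matrixP => i; rewrite !rowE !mulmxA (J2 (delta_mx 0 i)) mulmxDl.
rewrite -scalemxAl xi_J.
by rewrite scaler0 addr0 mulmxN mulNmx.
Qed.

Hypothesis bJ : forall u v, inner B (u *m J) (v *m J) = - inner B u v.
Hypothesis b_xil : forall v, inner B xi v = 0.
Hypothesis b_xir : forall u, inner B u xi = 0.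

(** As [J] is skew for the metric, this says that the operator representing [B] anticommutes with
    [J]: it is complex antilinear. *)
Lemma form_J u v : inner B u (v *m J) = inner B (u *m J) v.
Proof.
apply: oppr_inj; rewrite -bJ J2 innerDr innerNr innerZr b_xir mulr0 addr0 //.
Qed.

Let A := B - B^T.

Lemma inner_skew u v : inner A u v = inner B u v - inner B v u.
Proof. by rewrite innerDm innerNm inner_tr. Qed.

Hypothesis nondeg : forall u, pairing eta u = 0 ->
  (forall v, inner A u (v *m J) = 0) -> u = 0.

Lemma skew_rank : (n <= (\rank A).+1)%N.
Proof.
apply: (@mxrank_ker_cV _ _ _ eta) => u uA ue; apply: nondeg.
  by rewrite /pairing ue mxE.
by move=> v; rewrite /inner uA mul0mx mxE.
Qed.

(** The vector xi lies in the kernel of [A], and by nondegeneracy the corank is at most 1, so the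
    rank, a multiple of 4, is exactly [n.-1]. *)
Lemma skew_rank_dvd4 : (4 %| n.-1)%N.
Proof.
have AsT : A^T = - A by rewrite /A linearB /= trmxK opprB.
have JAJ : J *m A *m J^T = - A.
  apply: eq_inner => u v; rewrite -innerMr -innerMl innerNm !inner_skew.
  by rewrite !bJ opprB opprK addrC.
have JJA : J *m J *m A = - A.
  apply: eq_inner => u v; rewrite -innerMl mulmxA J2 innerDl innerZl innerNm innerNl.
  by rewrite [X in _ + _ * X]inner_skew b_xil b_xir subr0 mulr0 addr0.
have := mxrank_skew_anticommuting_real AsT J_cube JAJ JJA.
suff -> : \rank A = n.-1 by [].
apply/eqP; rewrite eqn_leq -ltnS -[X in _ && X]ltnS.
have xi0 : xi != 0.
  by apply: contra_eq_neq eta_xi => ->; rewrite /pairing mul0mx mxE eq_sym oner_eq0.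
have n0 : (0 < n)%N.
  by case: (n) xi xi0 => // xi'; rewrite thinmx0 eqxx.
rewrite prednK // skew_rank andbT ltn_neqAle rank_leq_row andbT.
apply/negP => rA; have /negP := xi0; apply.
have /row_freeP [K AK] : row_free A by [].
rewrite -[xi]mulmx1 -AK mulmxA (_ : xi *m A = 0) ?mul0mx //.
apply/rowP => j; have := inner_skew xi (delta_mx 0 j).
by rewrite b_xil b_xir subr0 {1}/inner trmx_delta -colE !mxE.
Qed.

Hypothesis n3 : (3 < n)%N.
Variable c : R.
(** The Ricci identity for the fundamental form on D = ker eta, with the curvature tensor of
    constant curvature [c] inserted on the left. *)
Hypothesis curvature : forall u v z w,
  pairing eta u = 0 -> pairing eta v = 0 -> pairing eta z = 0 ->
  pairing eta w = 0 ->
  c * (inner G v z * inner G u (w *m J) - inner G u z * inner G v (w *m J))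
  - c * (inner G v w * inner G u (z *m J) - inner G u w * inner G v (z *m J))
  = inner B u (w *m J) * inner B v z - inner B u (z *m J) * inner B v w
    - inner B v (w *m J) * inner B u z + inner B v (z *m J) * inner B u w.

Lemma exists_ker_rV k (N : 'M[R]_(n, k)) : (k < n)%N ->
  exists2 u : 'rV_n, u != 0 & u *m N = 0.
Proof.
move=> kn; have /rowV0Pn[u /sub_kermxP uN u0] : kermx N != 0.
  by rewrite kermx_eq0 /row_free neq_ltn (leq_ltn_trans (rank_leq_col _)).
by exists u.
Qed.

Lemma innerJJ u : pairing eta u = 0 -> u *m J *m J = - u.
Proof. by move=> e; rewrite J2 e scale0r addr0. Qed.

(** For [x] and [y] nonzero in D with [y] orthogonal to x and x J, two instances of [curvature] have
    the same right-hand side, while their left-hand sides are c |x|^2 |y|^2 and its opposite. *)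
Lemma curvature_ker_eq0 : c = 0.
Proof.
have [x x0] := exists_ker_rV eta (ltnW (ltnW n3)); move=> ex.
have {}ex : pairing eta x = 0 by rewrite /pairing ex mxE.
(* Three linear conditions put [y] in D and make it orthogonal to x and x J; a nonzero solution
   exists because [n] exceeds 3. *)
have [y y0] := exists_ker_rV (row_mx eta (row_mx (G *m x^T) (G *m (x *m J)^T))) n3.
rewrite !mul_mx_row => /eqP; rewrite !row_mx_eq0 => /and3P[/eqP ey /eqP yx /eqP yJx].
have {}ey : pairing eta y = 0 by rewrite /pairing ey mxE.
have {}yx : inner G y x = 0 by rewrite /inner -mulmxA yx mxE.
have {}yJx : inner G y (x *m J) = 0 by rewrite /inner -mulmxA yJx mxE.
have xJx : inner G x (x *m J) = 0.
  by have := inner_skewJ x x; rewrite (inner_sym _ x Gsym); lra.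
have xJy : inner G x (y *m J) = 0.
  by rewrite inner_skewJ (inner_sym _ _ Gsym) yJx oppr0.
(* Replacing u by J u amounts to replacing w by J w on the right-hand side, and
   by - J w on the left-hand side. *)
have := curvature (eta_J x) ey ey ex; have := curvature ex ey ey (eta_J x).
rewrite !(innerJJ ex) !compat !innerNr (inner_sym (x *m J) _ Gsym).
rewrite (inner_sym (x *m J) x Gsym) !(inner_sym x y Gsym) yx yJx xJx xJy ex ey.
rewrite !bJ -!form_J.
rewrite !(mul0r, mulr0, subr0, oppr0, addr0) => e1 e2.
have : c * (inner G y y * inner G x x) = 0 by lra.
by move/eqP; rewrite !mulf_eq0 => /orP[/eqP //|/orP[]]; rewrite gt_eqF ?Gpos.
Qed.

Lemma form_rank_le2 : (\rank B <= 2)%N.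
Proof.
have [Bt0|] := pselect (forall u w, inner B (u *m J) w = 0).
  suff -> : B = 0 by rewrite mxrank0.
  apply: eq_inner => u w; apply: oppr_inj; rewrite -bJ Bt0.
  by rewrite /inner mulmx0 mul0mx mxE oppr0.
move=> /existsNP[x' /existsNP[w0 bxw0]].
set x := x' *m J in bxw0; have ex : pairing eta x = 0 := eta_J x'.
have Gu : G \in unitmx.
  rewrite -row_free_unit -kermx_eq0; apply/negPn/negP => /rowV0Pn[u].
  by move=> /sub_kermxP uG u0; have := Gpos u0; rewrite /inner uG mul0mx mxE ltxx.
(* The metric dual of the covector B(x, -); it lies in D and is nonzero. *)
pose v := x *m B *m invmx G.
have bv w : inner B x w = inner G v w by rewrite /inner mulmxKV.
have ev : pairing eta v = 0 by rewrite -inner_xi -bv b_xir.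
have vJv : inner G v (v *m J) = 0.
  by have := inner_skewJ v v; rewrite (inner_sym _ v Gsym); lra.
have N0 : inner G v v != 0.
  rewrite gt_eqF // Gpos //; apply/eqP => v0; apply: bxw0.
  by rewrite bv v0 inner0l.
have bJJl u w : inner B (u *m J *m J) w = - inner B u w.
  by rewrite J2 innerDl innerNl innerZl b_xil mulr0 addr0.
have bJJr u w : inner B u (w *m J *m J) = - inner B u w.
  by rewrite J2 innerDr innerNr innerZr b_xir mulr0 addr0.
(* Once c = 0 the identity makes B x and B y complex dependent for all x, y. *)
have key y w : inner G v v * inner B y w =
    inner B y v * inner B x w - inner B y (v *m J) * inner B x (w *m J).
  (* The arguments must lie in D: [y *m J *m J] is minus the projection of [y], and [w *m J] makes
     [w *m J *m J] appear. The xi components are invisible to [B]. *)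
  have := curvature ex (eta_J (y *m J)) ev (eta_J w).
  rewrite curvature_ker_eq0 !mul0r subrr (bv (v *m J)) vJv mul0r subr0.
  by rewrite !bJJl !bJJr (bv v); lra.
(* By [key], [B] is a combination of two products of a column by a row, each of rank at most 1. *)
have -> : B = (inner G v v)^-1 *: (B *m v^T *m (x *m B)
    - B *m (v *m J)^T *m (x *m B *m J^T)).
  apply: eq_inner => y w; apply: (mulfI N0); rewrite key.
  rewrite innerZm mulrA divff // mul1r innerDm innerNm !inner_rank1 !mulmxA.
  by congr (_ - _ * _); rewrite /inner trmx_mul !mulmxA.
rewrite mxrank_scale_nz ?invr_neq0 // (leq_trans (mxrank_add _ _)) // mxrank_opp.
by rewrite (@leq_add _ _ 1 1) // (leq_trans (mxrankM_maxl _ _)) ?rank_leq_col.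
Qed.

Lemma skew_rank_le4 : (\rank A <= 4)%N.
Proof.
rewrite (leq_trans (mxrank_add _ _)) // mxrank_opp mxrank_tr.
by rewrite (@leq_add _ _ 2 2) ?form_rank_le2.
Qed.

End AlmostContact.

(** * Alternating forms *)

Section Forms.
Context {R : realType} {n : nat}.
Local Notation V := 'rV[R]_n.

Definition upd k (w : 'I_k -> V) (i : 'I_k) (u : V) : 'I_k -> V :=
  fun j => if j == i then u else w j.

Definition multilinear k (a : kform k) :=
  forall w i, scalar (fun u => a (upd w i u)).

Definition kernel_vector k (u : V) (a : kform k) :=
  forall w i, w i = u -> a w = 0.

Lemma upd_id k (w : 'I_k -> V) i : upd w i (w i) = w.
Proof. by apply/funext => j; rewrite /upd; case: eqP => // ->. Qed.

Lemma upd_inj k l (f : 'I_k -> 'I_l) w i u : injective f ->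
  (fun j => upd w (f i) u (f j)) = upd (w \o f) i u.
Proof. by move=> fI; apply/funext => j; rewrite /upd (inj_eq fI). Qed.

Lemma upd_notin k l (f : 'I_k -> 'I_l) w i u : (forall j, f j != i) ->
  (fun j => upd w i u (f j)) = w \o f.
Proof. by move=> fI; apply/funext => j; rewrite /upd (negPf (fI j)). Qed.

(** In the summand of [s], slot [i] feeds exactly one of the two factors, according to the side on
    which the preimage of [i] under [s] falls. *)
Lemma wedge_multilinear k l (a : kform k) (b : kform l) :
  multilinear a -> multilinear b -> multilinear (wedge a b).
Proof.
move=> am bm w i c u v; rewrite /wedge [X in _ = X + _]mulrCA -mulrDr; congr (_ * _).
rewrite mulr_sumr -big_split; apply: eq_bigr => s _ /=.
have sl : injective (fun j => s (lshift l j)) by move=> x y /perm_inj/lshift_inj.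
have sr : injective (fun j => s (rshift k j)) by move=> x y /perm_inj/rshift_inj.
case: (split_ordP ((s^-1)%g i)) => j /(canRL (permKV s)) ->.
  have nr j' : s (rshift k j') != s (lshift l j).
    by rewrite (inj_eq perm_inj) eq_rlshift.
  rewrite !(@upd_inj _ _ (fun j => s (lshift l j)) _ _ _ sl).
  rewrite !(@upd_notin _ _ (fun j => s (rshift k j)) _ _ _ nr) (am _ j c u v).
  by move: ((-1) ^+ s) (a _) (a _) (b _) => r x y z; rewrite -/(c * x); ring.
have nl j' : s (lshift l j') != s (rshift k j).
  by rewrite (inj_eq perm_inj) eq_lrshift.
rewrite !(@upd_inj _ _ (fun j => s (rshift k j)) _ _ _ sr).
rewrite !(@upd_notin _ _ (fun j => s (lshift l j)) _ _ _ nl) (bm _ j c u v).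
by move: ((-1) ^+ s) (b _) (b _) (a _) => r x y z; rewrite -/(c * x); ring.
Qed.

Lemma wedge_kernel_vector k l (a : kform k) (b : kform l) u :
  kernel_vector u a -> kernel_vector u b -> kernel_vector u (wedge a b).
Proof.
move=> au bu w i wi; rewrite /wedge big1 ?mulr0 // => s _.
case: (split_ordP ((s^-1)%g i)) => j /(canRL (permKV s)) ej.
  by rewrite (au _ j) ?mulr0 ?mul0r // -ej.
by rewrite (bu _ j) ?mulr0 // -ej.
Qed.

(** Summing over all permutations antisymmetrises the product; the sign comes out on reindexing by
    right translation by [t]. *)
Lemma wedge_perm k l (a : kform k) (b : kform l)
    (w : 'I_(k + l) -> V) (t : 'S_(k + l)) :
  wedge a b (w \o t) = (-1) ^+ t * wedge a b w.
Proof.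
rewrite /wedge [RHS]mulrCA; congr (_ * _).
rewrite [in RHS](reindex_inj (mulIg t)) /= mulr_sumr; apply: eq_bigr => s _.
rewrite odd_permM addbC signr_addb !mulrA -signr_addb addbb mul1r.
by congr (_ * a _ * b _); apply/funext => j; rewrite /= permM.
Qed.

(** Either the rows form a basis, which expresses [u], or they satisfy a nontrivial linear
    relation. *)
Lemma combination_of_rows p (P : 'M[R]_(p, n)) (u : V) : p = n -> u != 0 ->
  exists2 c : 'rV_p, c != 0 & c *m P = 0 \/ c *m P = u.
Proof.
move=> pn; move: P; rewrite pn => P u0.
have [Pu|] := boolP (P \in unitmx).
  exists (u *m invmx P); last by right; rewrite mulmxKV.
  by apply: contraNneq u0 => e; rewrite -(mulmxKV Pu u) e mul0mx.
rewrite -row_free_unit -kermx_eq0 => /rowV0Pn[c /sub_kermxP cP c0].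
by exists c => //; left.
Qed.

(** Take a combination of the vectors [w j] equal to 0 or [u], with a nonzero coefficient at some
    [i]. Putting it in slot [i] multiplies the alternating form by that coefficient, yet the result
    is 0. *)
Lemma top_wedge_eq0 k l (a : kform k) (b : kform l) u w : (k + l)%N = n ->
  multilinear a -> multilinear b -> kernel_vector u a -> kernel_vector u b ->
  u != 0 -> wedge a b w = 0.
Proof.
move=> kln am bm au bu u0; have Fm := wedge_multilinear am bm.
have Fu := wedge_kernel_vector au bu.
set F := wedge a b in Fm Fu *.
have Falt i j : i != j -> F (upd w i (w j)) = 0.
  move=> ij; have := wedge_perm a b (upd w i (w j)) (tperm i j).
  rewrite odd_tperm ij expr1 mulN1r -/F.
  have -> : upd w i (w j) \o tperm i j = upd w i (w j).
    apply/funext => x; rewrite /upd /=.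
    by case: tpermP => [->|->|_ _] //; rewrite eqxx eq_sym (negPf ij).
  by move=> e; lra.
pose FL i := GRing.isLinear.Build _ _ _ _ (fun x => F (upd w i x)) (Fm w i).
pose lF i : {linear V -> R^o} := HB.pack (fun x => F (upd w i x)) (FL i).
have F0 i : F (upd w i 0) = 0 by rewrite -[LHS]/(lF i 0) linear0.
have FZ i c x : F (upd w i (c *: x)) = c * F (upd w i x).
  by rewrite -[LHS]/(lF i _) linearZ.
pose P := \matrix_j w j.
suff [c c0 cP] : exists2 c : 'rV_(k + l), c != 0 & c *m P = 0 \/ c *m P = u.
  have [i ci] : exists i, c 0 i != 0.
    by apply/existsP; apply: contraNT c0 => /existsPn c0;
      apply/eqP/rowP => i; rewrite mxE; apply/eqP; have := c0 i; rewrite negbK.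
  apply: (mulfI ci); rewrite mulr0.
  have <- : F (upd w i (c *m P)) = c 0 i * F w.
    rewrite mulmx_sum_row -[LHS]/(lF i _) linear_sum (bigD1 i) //= big1 ?addr0.
      by rewrite FZ rowK upd_id.
    by move=> j ji; rewrite FZ rowK Falt ?mulr0 // eq_sym.
  by case: cP => ->; rewrite ?F0 //; apply: (Fu _ i); rewrite /upd eqxx.
exact: combination_of_rows.
Qed.

Lemma wedge_pow_multilinear (b : kform 2) m :
  multilinear b -> multilinear (wedge_pow b m).
Proof.
by move=> bm; elim: m => [w []//|m IH]; exact: (wedge_multilinear bm IH).
Qed.

Lemma wedge_pow_kernel_vector (b : kform 2) u m :
  kernel_vector u b -> kernel_vector u (wedge_pow b m).
Proof.
by move=> bu; elim: m => [w []//|m IH]; exact: (wedge_kernel_vector bu IH).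
Qed.

(** This turns the contact condition into nondegeneracy of d eta on ker eta: a common kernel vector
    of both factors would kill the top-degree wedge product. *)
Lemma contact_kernel m (a : 'cV[R]_n) (f : V -> V -> R) w u :
  (1 + m.*2)%N = n -> (forall v, scalar (f^~ v)) -> (forall v, scalar (f v)) ->
  wedge (one_kform a) (wedge_pow (two_kform f) m) w != 0 ->
  pairing a u = 0 -> (forall v, f u v = 0) -> (forall v, f v u = 0) -> u = 0.
Proof.
move=> mn fl fr wn0 au fu uf; apply/eqP; apply: contraNT wn0 => u0; apply/eqP.
apply: (top_wedge_eq0 w mn _ _ _ _ u0).
- move=> {}w i c x y; rewrite /one_kform /upd (ord1 i) eqxx /pairing.
  by rewrite mulmxDl -scalemxAl 2!mxE.
- apply: wedge_pow_multilinear => {}w i c x y; rewrite /two_kform /upd.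
  have : (i == 0) || (i == 1) by case: i => [[|[]]].
  by case/orP => /eqP -> /=; rewrite ?fl ?fr.
- by move=> {}w i; rewrite /one_kform (ord1 i) => ->.
- apply: wedge_pow_kernel_vector => {}w i; rewrite /two_kform.
  have : (i == 0) || (i == 1) by case: i => [[|[]]].
  by case/orP => /eqP -> ->.
Qed.

End Forms.

(** * Symmetry of second derivatives *)

Section SecondDerivatives.
Context {R : realType} {V : normedModType R}.
Implicit Types (f : V -> R) (x u v : V).

Lemma is_derive_line f x u (s : R) : differentiable f (s *: u + x) ->
  is_derive s 1 (fun t => f (t *: u + x)) ('D_u f (s *: u + x)).
Proof.
move=> df.
have eq_rate : (fun h : R => h^-1 *:
      (((fun t => f (t *: u + x)) \o shift s) (h *: 1) - f (s *: u + x)))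
    = (fun h => h^-1 *: ((f \o shift (s *: u + x)) (h *: u) - f (s *: u + x))).
  apply/funext => h /=; congr (_ *: (f _ - _)).
  by rewrite [h *: 1]mulr1 scalerDl addrA.
apply: DeriveDef; last by rewrite /derive eq_rate.
by rewrite /derivable eq_rate; exact: diff_derivable.
Qed.

Lemma differentiable_bound f x e : differentiable f x -> 0 < e ->
  exists2 d, 0 < d &
    forall h, `|h| < d -> `|f (h + x) - f x - 'd f x h| <= e * `|h|.
Proof.
move=> df e0; have := diff_locally df => /eqaddoP/(_ e e0)/nbhs_norm0P[d /= d0 dP].
exists d => // h hd; have := dP h hd.
by rewrite !fctE opprD addrA.
Qed.

(** The mean value theorem, applied along [u] to the increment of [f] by [t *: v], writes the second
    difference as [t] times an increment of ['D_u f], which is then linearised at [x]. *)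
Lemma second_difference f x u v e (U : set V) : open U -> U x ->
  (forall y, U y -> differentiable f y) -> differentiable ('D_u f) x -> 0 < e ->
  \forall t \near (0 : R)^'+,
    `|f (t *: u + (t *: v + x)) - f (t *: u + x) - (f (t *: v + x) - f x)
      - t ^+ 2 * 'D_v ('D_u f) x| <= e * t ^+ 2.
Proof.
move=> Uo Ux df ddf e0.
(* Both displacements from [x] have norm at most t (|u| + |v|), so their two errors with constant e
   / c add up to at most e t; the extra 1 keeps [c] positive. *)
pose c := 2 * (`|u| + `|v|) + 1.
have nu := normr_ge0 u; have nv := normr_ge0 v.
have c0 : 0 < c by rewrite /c; lra.
have [d1 d10 bd1] := differentiable_bound ddf (divr_gt0 e0 c0).
have [d2 d20 bd2] : exists2 d, 0 < d & forall h, `|h| < d -> U (h + x).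
  have /nbhs_normP[d /= d0 dU] := open_nbhs_nbhs (conj Uo Ux).
  by exists d => // h hd; apply: dU; rewrite /= opprD addrCA subrr addr0 normrN.
near=> t.
have t0 : 0 < t by [].
have tc1 : t * c < d1.
  by rewrite -ltr_pdivlMr //; near: t; apply: nbhs_right_lt; exact: divr_gt0.
have tc2 : t * c < d2.
  by rewrite -ltr_pdivlMr //; near: t; apply: nbhs_right_lt; exact: divr_gt0.
(* The boolean selects one of the two segments, starting at [t *: v + x] or at [x]. *)
have small s (b : bool) : s \in `[0, t]%R ->
    `|s *: u + (if b then t else 0) *: v| <= t * (`|u| + `|v|).
  rewrite in_itv /= => /andP[s0 st]; rewrite (le_trans (ler_normD _ _)) // mulrDr.
  rewrite !normrZ (ger0_norm s0) lerD ?ler_wpM2r //.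
  by case: b; rewrite ?normr0 ?ger0_norm // ltW.
have tuv : t * (`|u| + `|v|) < t * c.
  by rewrite ltr_pM2l // /c; lra.
have inU s (b : bool) : s \in `[0, t]%R ->
    U (s *: u + ((if b then t else 0) *: v + x)).
  move=> st; rewrite addrA; apply: bd2; apply: le_lt_trans (small s b st) _.
  exact: lt_trans tuv tc2.
pose F s := f (s *: u + (t *: v + x)) - f (s *: u + x).
pose dF s := 'D_u f (s *: u + (t *: v + x)) - 'D_u f (s *: u + x).
have FdF s : s \in `[0, t]%R -> is_derive s 1 F (dF s).
  move=> st; apply: is_deriveB; apply: is_derive_line; apply: df.
    exact: (inU s true).
  by have := inU s false st; rewrite scale0r add0r.
have cF : {within `[0, t], continuous F}.
  by apply: derivable_within_continuous => s /FdF[].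
have dF' s : s \in `]0, t[%R -> is_derive s 1 F (dF s).
  by move=> st; apply: FdF; exact: subset_itv_oo_cc st.
have [s /subset_itv_oo_cc st] := @MVT R F dF 0 t t0 dF' cF.
rewrite /F !scale0r !add0r subr0 => ->.
have b1 := bd1 _ (le_lt_trans (small s true st) (lt_trans tuv tc1)).
have b2 := bd1 _ (le_lt_trans (small s false st) (lt_trans tuv tc1)).
rewrite scale0r addr0 in b2.
have -> : dF s * t - t ^+ 2 * 'D_v ('D_u f) x = t *
   (('D_u f (s *: u + t *: v + x) - 'D_u f x - 'd ('D_u f) x (s *: u + t *: v))
   - ('D_u f (s *: u + x) - 'D_u f x - 'd ('D_u f) x (s *: u))).
  have dv : 'd ('D_u f) x (t *: v) = t * 'D_v ('D_u f) x.
    by rewrite deriveE // linearZ.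
  by rewrite /dF addrA linearD dv; ring.
rewrite normrM gtr0_norm // mulrC [in leRHS]expr2 mulrA ler_pM2r //.
rewrite (le_trans (ler_normB _ _)) // (le_trans (lerD b1 b2)) // -mulrDr.
rewrite -mulrA ler_pM2l // mulrC ler_pdivrMr //.
have := small s true st; have := small s false st; rewrite scale0r addr0.
by rewrite /c; lra.
Unshelve. all: by end_near. Qed.

(** The second difference is symmetric in [u] and [v], so both iterated derivatives approximate it
    up to e t^2. With e a quarter of their distance this is a contradiction unless they agree. *)
Lemma derive_comm f x u v (U : set V) : open U -> U x ->
  (forall y, U y -> differentiable f y) ->
  differentiable ('D_u f) x -> differentiable ('D_v f) x ->
  'D_v ('D_u f) x = 'D_u ('D_v f) x.
Proof.
move=> Uo Ux df du dv.
have nuv := fun e => second_difference v Uo Ux df du (e := e).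
have nvu := fun e => second_difference u Uo Ux df dv (e := e).
move: ('D_v ('D_u f) x : R) ('D_u ('D_v f) x : R) nuv nvu => A B nuv nvu.
apply/eqP; apply: contraT => neq.
have e0 : 0 < `|A - B| / 4 by rewrite divr_gt0 // normr_gt0 subr_eq0.
have [t [[]]] :=
  filter_ex (filterI (filterI (nuv _ e0) (nvu _ e0)) (nbhs_right_gt (0 : R))).
rewrite (addrCA (t *: v)).
move: (f _) (f (t *: u + x)) (f (t *: v + x)) (f x) => a b c d uv vu t0.
have : `|t ^+ 2 * (A - B)| <= `|A - B| / 4 * t ^+ 2 + `|A - B| / 4 * t ^+ 2.
  apply: le_trans (lerD vu uv); apply: le_trans (ler_normB _ _).
  by rewrite le_eqVlt; apply/orP; left; apply/eqP; congr (`|_|); ring.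
rewrite normrM ger0_norm ?sqr_ge0 // [leLHS]mulrC -mulrDl ler_pM2r ?exprn_gt0 //.
by lra.
Qed.

End SecondDerivatives.

(** * Differentiability of matrix entries and twice differentiable functions *)

Section Differentiable.
Context {R : realType} {V : normedModType R}.
Implicit Types (f g : V -> R) (x v : V) (U : set V).

Lemma near_eq_differentiable f g x :
  {near x, f =1 g} -> differentiable f x -> differentiable g x.
Proof.
move=> fg df; have [dfc fE] := (diff_locallyP x f).1 df.
have gE : g \o shift x = cst (g x) + 'd f x +o_ 0 id.
  apply/eqaddoP => e e0; have /eqaddoP/(_ e e0) fo := fE.
  have fg0 : \forall h \near 0, f (h + x) = g (h + x).
    have := fg; rewrite (near_shift 0 x) /=; apply: filterS => h /=.
    by rewrite subr0.
  move: fo fg0; apply: filterS2 => h; rewrite !fctE /= => fo fgh.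
  by rewrite -fgh -(nbhs_singleton fg).
have dg : 'd g x = 'd f x :> (V -> R) by apply: diff_unique.
by apply/diff_locallyP; rewrite dg.
Qed.

Lemma differentiable_bigsum (I : Type) (r : seq I) (P : pred I) 
    (F : I -> V -> R) x :
  (forall i, differentiable (F i) x) ->
  differentiable (fun y => \sum_(i <- r | P i) F i y) x.
Proof.
move=> dF; elim: r => [|i r IH].
  under eq_fun do rewrite big_nil; exact: differentiable_cst.
under eq_fun do rewrite big_cons; case: (P i) => //.
exact: differentiableD.
Qed.

Lemma differentiable_bigprod (I : Type) (r : seq I) (P : pred I) 
    (F : I -> V -> R) x :
  (forall i, differentiable (F i) x) ->
  differentiable (fun y => \prod_(i <- r | P i) F i y) x.
Proof.
move=> dF; elim: r => [|i r IH].
  under eq_fun do rewrite big_nil; exact: differentiable_cst.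
under eq_fun do rewrite big_cons; case: (P i) => //.
exact: differentiableM.
Qed.

Lemma differentiable_det n (M : V -> 'M[R]_n) x :
  (forall i j, differentiable (fun y => M y i j) x) ->
  differentiable (fun y => \det (M y)) x.
Proof.
move=> dM; apply: differentiable_bigsum => s; apply: differentiableM => //.
exact: differentiable_bigprod.
Qed.

(** Near [x] the inverse is the transposed cofactor matrix divided by the determinant, both
    polynomial in the entries. *)
Lemma differentiable_invmx n (M : V -> 'M[R]_n) x i j :
  (forall i j, differentiable (fun y => M y i j) x) ->
  (\forall y \near x, M y \in unitmx) ->
  differentiable (fun y => invmx (M y) i j) x.
Proof.
move=> dM Mu.
apply: (@near_eq_differentiable (fun y => (\det (M y))^-1 * cofactor (M y) j i)).
  by apply: filterS Mu => y yu; rewrite /invmx yu !mxE.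
apply: differentiableM; first apply: differentiableV.
- exact: differentiable_det.
- by rewrite -unitfE -unitmxE; exact: nbhs_singleton Mu.
- apply: differentiableM => //; apply: differentiable_det => a b.
  by under eq_fun do rewrite !mxE; exact: dM.
Qed.

Definition diff_on U f := forall x, U x -> differentiable f x.

(** Twice differentiable in the sense that [derive_comm] asks for, with no continuity imposed on the
    second derivatives. *)
Definition C2_on U f := diff_on U f /\ forall v, diff_on U ('D_v f).

Lemma C2_on_cst U (c : R) : C2_on U (cst c).
Proof.
split=> [x _|v x _]; first exact: differentiable_cst.
rewrite (_ : 'D_v _ = cst 0); first exact: differentiable_cst.
by apply/funext => y; rewrite derive_cst.
Qed.

Lemma open_near U x (P : V -> Prop) : open U -> U x -> (forall y, U y -> P y) ->
  \forall y \near x, P y.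
Proof. by move=> Uo Ux UP; exact: filterS UP (open_nbhs_nbhs (conj Uo Ux)). Qed.

Lemma C2_onD U f g : open U -> C2_on U f -> C2_on U g -> C2_on U (f \+ g).
Proof.
move=> Uo [df ddf] [dg ddg]; split=> [x Ux|v x Ux].
  by apply: differentiableD; [exact: df | exact: dg].
apply: (@near_eq_differentiable ('D_v f + 'D_v g)).
  apply: open_near Uo Ux _ => y Uy; rewrite [RHS]deriveD //; apply: diff_derivable.
    exact: df.
  exact: dg.
by apply: differentiableD; [exact: ddf | exact: ddg].
Qed.

Lemma C2_onM U f g : open U -> C2_on U f -> C2_on U g -> C2_on U (f \* g).
Proof.
move=> Uo [df ddf] [dg ddg]; split=> [x Ux|v x Ux].
  by apply: differentiableM; [exact: df | exact: dg].
apply: (@near_eq_differentiable (f * 'D_v g + g * 'D_v f)).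
  apply: open_near Uo Ux _ => y Uy; rewrite [RHS]deriveM //; apply: diff_derivable.
    exact: df.
  exact: dg.
by apply: differentiableD; apply: differentiableM;
  [exact: df | exact: ddg | exact: dg | exact: ddf].
Qed.

Lemma C2_on_sum U (I : Type) (r : seq I) (F : I -> V -> R) : open U ->
  (forall i, C2_on U (F i)) -> C2_on U (fun y => \sum_(i <- r) F i y).
Proof.
move=> Uo F2; elim: r => [|i r IH].
  under eq_fun do rewrite big_nil; exact: C2_on_cst.
by under eq_fun do rewrite big_cons; exact: C2_onD.
Qed.

Lemma derive_comm_on U f u v x : open U -> C2_on U f -> U x ->
  'D_v ('D_u f) x = 'D_u ('D_v f) x.
Proof.
by move=> Uo [df ddf] Ux; apply: (@derive_comm _ _ _ _ _ _ U) => //; exact: ddf.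
Qed.

Lemma C2_on_coord p q U (M : V -> 'M[R]_(p, q)) i j : open U -> smooth_on U M ->
  C2_on U (fun y => M y i j).
Proof.
move=> Uo sM; have [dM ddM] := sM 2.
have coord (N : V -> 'M[R]_(p, q)) y : differentiable N y ->
    differentiable (fun y => N y i j) y.
  by move=> dN; exact: (differentiable_comp dN (differentiable_coord _ _ _)).
split=> [x Ux|v x Ux]; first exact/coord/dM.
apply: (@near_eq_differentiable (fun y => 'D_v M y i j)).
  apply: open_near Uo Ux _ => y Uy.
  by rewrite derive_mx ?mxE //; apply/diff_derivable/dM.
by apply: coord; have [+ _] := ddM v; exact.
Qed.

End Differentiable.

(** * Connections in a chart *)

Section MatrixFields.
Context {R : realType} {V : normedModType R} {n : nat}.
Implicit Types (H K : V -> 'M[R]_n) (X Y : V -> 'rV[R]_n) (U : set V).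

Definition entries_diff p q (N : V -> 'M[R]_(p, q)) x :=
  forall a b, differentiable (fun y => N y a b) x.

Definition entries_C2 U H := forall a b, C2_on U (fun y => H y a b).

Lemma entries_C2_mul U H K : open U -> entries_C2 U H -> entries_C2 U K ->
  entries_C2 U (fun y => H y *m K y).
Proof.
move=> Uo H2 K2 a b; under eq_fun do rewrite mxE.
by apply: C2_on_sum => // c; exact: C2_onM.
Qed.

Lemma entries_C2_tr U H : entries_C2 U H -> entries_C2 U (fun y => (H y)^T).
Proof. by move=> H2 a b; under eq_fun do rewrite mxE. Qed.

Lemma entries_C2_diff U H x : entries_C2 U H -> U x -> entries_diff H x.
Proof. by move=> H2 Ux a b; have [+ _] := H2 a b; exact. Qed.

Lemma C2_on_inner U H u v : open U -> entries_C2 U H ->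
  C2_on U (fun y => inner (H y) u v).
Proof.
move=> Uo H2; under eq_fun do rewrite innerE.
do 2![apply: C2_on_sum => // ?]; apply: C2_onM => //; exact: C2_on_cst.
Qed.

(** The Leibniz rule for three factors; in the first term on the right the two vector fields are
    frozen at [x]. *)
Lemma derive_inner H X Y x u :
  entries_diff H x -> entries_diff X x -> entries_diff Y x ->
  'D_u (fun y => inner (H y) (X y) (Y y)) x =
  'D_u (fun y => inner (H y) (X x) (Y x)) x
  + inner (H x) ('D_u X x) (Y x) + inner (H x) (X x) ('D_u Y x).
Proof.
move=> dH dX dY.
have entry (Z : V -> 'rV[R]_n) a : entries_diff Z x ->
    is_derive x u (fun y => Z y 0 a) ('D_u Z x 0 a).
  move=> dZ; have dZ' : derivable Z x u.
    by apply/derivable_mxP => b c; exact: diff_derivable.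
  by rewrite derive_mx // mxE; apply: DeriveDef => //; exact: diff_derivable.
have entryH a b : is_derive x u (fun y => H y a b) ('D_u (fun y => H y a b) x).
  by apply: DeriveDef => //; exact: diff_derivable.
have expand (F G : V -> 'rV[R]_n) : entries_diff F x -> entries_diff G x ->
    is_derive x u (fun y => inner (H y) (F y) (G y))
     (\sum_a \sum_b ((F x 0 a * G x 0 b) * 'D_u (fun y => H y a b) x
      + H x a b * (F x 0 a * 'D_u G x 0 b + G x 0 b * 'D_u F x 0 a))).
  move=> dF dG.
  have -> : (fun y => inner (H y) (F y) (G y)) = \sum_a \sum_b
      (((fun y => F y 0 a) * (fun y => G y 0 b)) * (fun y => H y a b)).
    apply/funext => y; rewrite innerE fct_sumE; apply: eq_bigr => a _.
    by rewrite fct_sumE.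
  apply: is_derive_sum => a; apply: is_derive_sum => b.
  by apply: is_deriveM; apply: is_deriveM; exact: entry.
have dc (w : 'rV[R]_n) : entries_diff (cst w) x.
  by move=> a b; exact: differentiable_cst.
have [_ ->] := expand X Y dX dY.
have [_ ->] := expand _ _ (dc (X x)) (dc (Y x)).
rewrite !innerE -!big_split; apply: eq_bigr => a _.
rewrite -!big_split; apply: eq_bigr => b _ /=.
by rewrite !derive_cst !mxE; ring.
Qed.

Lemma differentiable_inner_entries H X Y x :
  entries_diff H x -> entries_diff X x -> entries_diff Y x ->
  differentiable (fun y => inner (H y) (X y) (Y y)) x.
Proof.
move=> dH dX dY; under eq_fun do rewrite innerE.
do 2![apply: differentiable_bigsum => ?].
by apply: differentiableM => //; exact: differentiableM.
Qed.

Lemma entries_diff_cst p q (N : 'M[R]_(p, q)) (x : V) :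
  entries_diff (fun=> N) x.
Proof. by move=> a b; exact: differentiable_cst. Qed.

Lemma derive_innerl H X x u w : entries_diff H x -> entries_diff X x ->
  'D_u (fun y => inner (H y) (X y) w) x =
  'D_u (fun y => inner (H y) (X x) w) x + inner (H x) ('D_u X x) w.
Proof.
move=> dH dX; rewrite (derive_inner u dH dX (entries_diff_cst w x)).
by rewrite (derive_cst w x u) inner0r addr0.
Qed.

Lemma derive_innerr H Y x u z : entries_diff H x -> entries_diff Y x ->
  'D_u (fun y => inner (H y) z (Y y)) x =
  'D_u (fun y => inner (H y) z (Y x)) x + inner (H x) z ('D_u Y x).
Proof.
move=> dH dY; rewrite (derive_inner u dH (entries_diff_cst z x) dY).
by rewrite (derive_cst z x u) inner0l addr0.
Qed.

End MatrixFields.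

(** * The Ricci and Bianchi identities *)

Section Connection.
Context {R : realType} {n : nat}.
Local Notation V := 'rV[R]_n.
Variables (Gamma : V -> V -> V -> V) (U : set V).
Hypothesis Uo : open U.
Hypothesis Gamma_diff :
  forall x u v, U x -> entries_diff (fun y => Gamma y u v) x.
Implicit Types (H : V -> 'M[R]_n) (x u v w z : V).

(** The value (nabla_u H)(z, w), with [z] and [w] extended as constant fields. *)
Definition covariant_derivative H x u z w := 'D_u (fun y => inner (H y) z w) x
  - inner (H x) (Gamma x u z) w - inner (H x) z (Gamma x u w).

Local Notation cov := covariant_derivative.

(** The vector R(u, v)w computed on constant fields, whose bracket vanishes. *)
Definition curvature_of_connection x u v w :=
  'D_u (fun y => Gamma y v w) x + Gamma x u (Gamma x v w)
  - ('D_v (fun y => Gamma y u w) x + Gamma x v (Gamma x u w)).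

Lemma differentiable_cov H x u z w : entries_C2 U H -> U x ->
  differentiable (fun y => cov H y u z w) x.
Proof.
move=> H2 Ux; have dH := entries_C2_diff H2 Ux.
apply: differentiableB; first apply: differentiableB.
- by have [_ +] := C2_on_inner z w Uo H2; exact.
- exact: (differentiable_inner_entries dH (Gamma_diff u z Ux) (entries_diff_cst _ _)).
- exact: (differentiable_inner_entries dH (entries_diff_cst _ _) (Gamma_diff u w Ux)).
Qed.

Lemma derive_cov H x u v z w : entries_C2 U H -> U x ->
  'D_u (fun y => cov H y v z w) x =
  'D_u ('D_v (fun y => inner (H y) z w)) x
  - (cov H x u (Gamma x v z) w + inner (H x) (Gamma x u (Gamma x v z)) w
     + inner (H x) (Gamma x v z) (Gamma x u w)
     + inner (H x) ('D_u (fun y => Gamma y v z) x) w)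
  - (cov H x u z (Gamma x v w) + inner (H x) (Gamma x u z) (Gamma x v w)
     + inner (H x) z (Gamma x u (Gamma x v w))
     + inner (H x) z ('D_u (fun y => Gamma y v w) x)).
Proof.
move=> H2 Ux; have dH := entries_C2_diff H2 Ux.
have d1 : derivable ('D_v (fun y => inner (H y) z w)) x u.
  by apply: diff_derivable; have [_ +] := C2_on_inner z w Uo H2; exact.
have d2 : derivable (fun y => inner (H y) (Gamma y v z) w) x u.
  apply: diff_derivable.
  exact: (differentiable_inner_entries dH (Gamma_diff v z Ux) (entries_diff_cst _ _)).
have d3 : derivable (fun y => inner (H y) z (Gamma y v w)) x u.
  apply: diff_derivable.
  exact: (differentiable_inner_entries dH (entries_diff_cst _ _) (Gamma_diff v w Ux)).
rewrite [LHS](deriveB (derivableB d1 d2) d3) (deriveB d1 d2).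
rewrite (derive_innerl u w dH (Gamma_diff v z Ux)).
rewrite (derive_innerr u z dH (Gamma_diff v w Ux)) /cov.
by ring.
Qed.

(** On antisymmetrising [derive_cov], the second derivatives of [H] cancel by symmetry and the
    products of two Christoffel vectors cancel in pairs; what remains of the last terms is the
    curvature. *)
Lemma ricci_identity H x u v z w : entries_C2 U H -> U x ->
  'D_u (fun y => cov H y v z w) x - 'D_v (fun y => cov H y u z w) x =
  cov H x v (Gamma x u z) w + cov H x v z (Gamma x u w)
  - cov H x u (Gamma x v z) w - cov H x u z (Gamma x v w)
  - inner (H x) (curvature_of_connection x u v z) w
  - inner (H x) z (curvature_of_connection x u v w).
Proof.
move=> H2 Ux; rewrite !derive_cov //.
have -> := derive_comm_on u v Uo (C2_on_inner z w Uo H2) Ux.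
rewrite /curvature_of_connection !(innerDl, innerDr, innerNl, innerNr).
do 4![move: (cov _ _ _ _ _) => ?]; do 8![move: (inner (H x) _ _) => ?].
move: ('D_u _ x) => ?; ring.
Qed.

Lemma curvature_parallel H x u v z w : entries_C2 U H ->
  (forall y a b c, U y -> cov H y a b c = 0) -> U x ->
  inner (H x) (curvature_of_connection x u v z) w
  = - inner (H x) z (curvature_of_connection x u v w).
Proof.
move=> H2 cov0 Ux; have D0 a b c d : 'D_a (fun y => cov H y b c d) x = 0.
  rewrite -(derive_cst (0 : R) x a); apply: near_eq_derive.
  by apply: open_near Uo Ux _ => y Uy; exact: cov0.
have := ricci_identity u v z w H2 Ux.
rewrite (D0 u v z w) (D0 v u z w) !(cov0 x _ _ _ Ux).
by move: (inner _ _ _) (inner _ _ _) => a b; lra.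
Qed.

Lemma curvature_bianchi x u v z :
  (forall y a b, U y -> Gamma y a b = Gamma y b a) -> U x ->
  curvature_of_connection x u v z + curvature_of_connection x v z u
  + curvature_of_connection x z u v = 0.
Proof.
move=> Gsym Ux.
have Ds a b c : 'D_a (fun y => Gamma y b c) x = 'D_a (fun y => Gamma y c b) x.
  by apply: near_eq_derive; apply: open_near Uo Ux _ => y Uy; exact: Gsym.
rewrite /curvature_of_connection (Ds u z v) (Ds v u z) (Ds z v u).
rewrite (Gsym x z v Ux) (Gsym x z u Ux) (Gsym x v u Ux).
move: (Gamma x u (Gamma x v z)) (Gamma x v _) (Gamma x z _) => a b c.
move: ('D_u _ x) ('D_v _ x) ('D_z _ x) => d e f.
by apply/rowP => k; rewrite !mxE; ring.
Qed.

End Connection.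

(** * The Levi-Civita connection *)

Section Curvature.
Context {R : realType} {n : nat} {M : smooth_manifold R n}.
Variables (g : riemannian_metric M) (i : chart_index M).
Local Notation V := 'rV[R]_n.
Implicit Types (x u v w z : V) (H : V -> 'M[R]_n).

Local Notation U := (@chart_img R n M i).
Local Notation G := (g i).
Local Notation Gamma := (christoffel (g i)).
Let Uo : open U. Proof. exact: chart_img_open. Qed.

Lemma metric_C2 : entries_C2 U G.
Proof. by move=> a b; apply: C2_on_coord => //; exact: rm_smooth. Qed.

Lemma riemannian_inner_sym x u v : U x -> inner (G x) u v = inner (G x) v u.
Proof. by move=> Ux; apply: inner_sym; exact: rm_sym. Qed.

Lemma bracket_cst u v : bracket (cst u) (cst v) = cst 0 :> (V -> V).
Proof. by apply/funext => y; rewrite /bracket !derive_cst subrr. Qed.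

Lemma christoffel_sym x u v : U x -> Gamma x u v = Gamma x v u.
Proof.
move=> Ux; have := nabla_torsion_free g (cst u) (cst v) Ux.
rewrite bracket_cst (nabla_cst _ x u v) (nabla_cst _ x v u) => /eqP.
by rewrite subr_eq0 => /eqP.
Qed.

Lemma metric_compat x u v w : U x -> 'D_w (fun y => inner (G y) u v) x =
  inner (G x) (Gamma x w u) v + inner (G x) u (Gamma x w v).
Proof. by move=> Ux; rewrite (nabla_metric g w u v Ux) !nabla_cst. Qed.

Lemma christoffel_diff x u v : U x -> entries_diff (fun y => Gamma y u v) x.
Proof.
move=> Ux a b; have dG c d w : differentiable ('D_w (fun y => inner (G y) c d)) x.
  by have [_ +] := C2_on_inner c d Uo metric_C2; exact.
rewrite /christoffel; under eq_fun do rewrite mxE.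
apply: differentiable_bigsum => d; apply: differentiableM.
  under eq_fun do rewrite 2!mxE.
  apply: differentiableM; first exact: differentiable_cst.
  by apply: differentiableB; first apply: differentiableD; exact: dG.
apply: differentiable_invmx => [c e|]; first exact: entries_C2_diff metric_C2 Ux _ _.
by apply: open_near Uo Ux _ => y Uy; exact: riemannian_metric_unit.
Qed.

Lemma christoffel0l x w : Gamma x 0 w = 0.
Proof.
rewrite /christoffel (_ : koszul _ _ _ _ = 0) ?scaler0 ?mul0mx //.
apply/rowP => d; rewrite !mxE /= derive0 add0r.
have cst0 (e : V) : (fun y => inner (g i y) 0 e) = cst 0.
  by apply/funext => y; rewrite inner0l.
by rewrite !cst0 !derive_cst subrr.
Qed.

Lemma curvE x u v w : curv G x u v w = curvature_of_connection Gamma x u v w.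
Proof.
rewrite /curv /curv_field.
have nab a b : nabla G (cst a) (cst b) = fun y => Gamma y a b.
  by apply/funext => y; rewrite nabla_cst.
by rewrite bracket_cst !nab christoffel0l subr0.
Qed.

Local Notation cov := (covariant_derivative Gamma).

(** The fundamental form is the bilinear form of the matrix G phi^T, which brings it within reach of
    [ricci_identity]. *)
Lemma nabla_PhiE (phi : V -> 'M[R]_n) x u z w :
  nabla_Phi G phi x u z w = cov (fun y => G y *m (phi y)^T) x u z w.
Proof.
have PhiE y a b : fundamental_form G phi y a b = inner (G y *m (phi y)^T) a b.
  exact: innerMr.
rewrite /nabla_Phi /nabla_Phi_field /covariant_derivative.
rewrite (nabla_cst _ x u z) (nabla_cst _ x u w) !PhiE; congr (_ - _ - _).
by congr ('D_u _ x); apply/funext => y; exact: PhiE.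
Qed.

Lemma curv_antisym12 x u v z : curv G x u v z = - curv G x v u z.
Proof. by rewrite !curvE opprB. Qed.

Lemma curv_bianchi x u v z : U x ->
  curv G x u v z + curv G x v z u + curv G x z u v = 0.
Proof.
move=> Ux; rewrite !curvE.
exact: (curvature_bianchi Uo u v z (fun y a b => @christoffel_sym y a b) Ux).
Qed.

Lemma curv_antisym34 x u v z w : U x ->
  inner (G x) (curv G x u v z) w = - inner (G x) (curv G x u v w) z.
Proof.
move=> Ux; have cov0 y a b c : U y -> cov G y a b c = 0.
  move=> Uy; rewrite /covariant_derivative (metric_compat _ _ _ Uy).
  by rewrite addrAC addrK subrr.
rewrite (curvE x u v z) (curvE x u v w).
apply: etrans
  (curvature_parallel Uo christoffel_diff u v z w metric_C2 cov0 Ux) _.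
by congr (- _); exact: riemannian_inner_sym.
Qed.

(** The map [T] stands for the projection onto D: pulling the curvature back along it gives a tensor
    on the whole space, to which [constant_sectional_curvature] applies. *)
Lemma sectional_curvature_ker (T : V -> V) x (c : R) : U x ->
  {morph T : u v / u + v} ->
  (forall u v, row_free (col_mx (T u) (T v)) -> sectional G x (T u) (T v) = c) ->
  forall u v z w, inner (G x) (curv G x (T u) (T v) (T z)) (T w) =
    c * (inner (G x) (T v) (T z) * inner (G x) (T u) (T w)
         - inner (G x) (T u) (T z) * inner (G x) (T v) (T w)).
Proof.
move=> Ux TD Tc.
have sC u v : inner (G x) (T u) (T v) = inner (G x) (T v) (T u).
  exact: riemannian_inner_sym.
apply: (constant_sectional_curvature
  (s := fun u v => inner (G x) (T u) (T v))
  (K := fun u v z w => inner (G x) (curv G x (T u) (T v) (T z)) (T w))) => //.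
- by move=> u v v'; rewrite TD innerDr.
- by move=> u v z w w'; rewrite TD innerDr.
- by move=> u v z w; rewrite (curv_antisym12 x (T u)) innerNl.
- by move=> u v z w; exact: curv_antisym34.
- move=> u v z w; rewrite -!innerDl curv_bianchi ?inner0l //.
move=> u v; have [uv|] := boolP (row_free (col_mx (T u) (T v))).
  rewrite -(Tc _ _ uv) /sectional mulfVK //.
  by apply: gram_neq0 uv => [|w]; [exact: rm_sym | exact: rm_pos].
have K0 a b z : inner (G x) (curv G x a b z) z = 0.
  by have := curv_antisym34 a b z z Ux; move: (inner _ _ _) => k; lra.
(* When [T u] and [T v] are dependent they span no plane, and both sides vanish. *)
case/row_free_col_mx2N => -[k e].
  have -> : inner (G x) (curv G x (T u) (T v) (T v)) (T u) = 0.
    by rewrite [X in inner _ _ X]e innerZr K0 mulr0.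
  by rewrite e !(innerZl, innerZr); ring.
rewrite (curv_antisym34 (T u) (T v) (T v) (T u) Ux).
have -> : inner (G x) (curv G x (T u) (T v) (T u)) (T v) = 0.
  by rewrite [X in inner _ _ X]e innerZr K0 mulr0.
by rewrite e !(innerZl, innerZr); ring.
Qed.

End Curvature.

(** * The classes C9 and C10 *)

Section ChineaGonzalez.
Context {R : realType} {n : nat}.
Variables (J : 'M[R]_n) (xi : 'rV[R]_n) (eta : 'cV[R]_n).
Hypothesis eta_xi : pairing eta xi = 1.
Hypothesis xiJ : xi *m J = 0.

(** At z = xi the defining relations make a(x, y, xi) symmetric in x, y on C9 and skew on C10. At y
    = xi, skewness in the last two arguments gives the anti-invariance under phi. Both relations
    then reduce to one formula. *)
Lemma C9_C10_form alpha : in_C9_C10 J xi eta alpha ->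
  [/\ forall x y z, alpha x y z
        = pairing eta z * alpha x y xi - pairing eta y * alpha x z xi,
      forall x y, alpha (x *m J) (y *m J) xi = - alpha x y xi,
      forall y, alpha xi y xi = 0 &
      forall x, alpha x xi xi = 0].
Proof.
move=> [a9 [a10 [[[[_ l9 _] c9] h9] [[[_ l10 _] c10] h10] aE]]].
have lin0 (f : 'rV[R]_n -> R) : scalar f -> f 0 = 0.
  by move=> lf; have := lf (-1) 0 0; rewrite scaler0 addr0 mulN1r addNr.
have a9_0 x z : a9 x 0 z = 0 := lin0 _ (l9 x z).
have a10_0 x z : a10 x 0 z = 0 := lin0 _ (l10 x z).
have xixi9 x : a9 x xi xi = 0 by have [] := c9 x xi xi; lra.
have xixi10 x : a10 x xi xi = 0 by have [] := c10 x xi xi; lra.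
have sym9 x y : a9 x y xi = a9 y x xi.
  by rewrite h9 eta_xi xiJ a9_0 mul1r mulr0 addr0.
have sym10 x y : a10 x y xi = - a10 y x xi.
  by rewrite h10 eta_xi xiJ a10_0 mul1r mulr0 addr0.
have J9 x z : a9 (x *m J) (z *m J) xi = - a9 x z xi.
  have [+ _] := c9 x z xi; rewrite (h9 x xi z) (sym9 xi x) xixi9 eta_xi; lra.
have J10 x z : a10 (x *m J) (z *m J) xi = - a10 x z xi.
  have [+ _] := c10 x z xi; rewrite (h10 x xi z) (sym10 xi x) xixi10 eta_xi; lra.
split.
- move=> x y z; rewrite !aE (h9 x y z) (h10 x y z) (sym9 y) (sym10 y) J9 J10.
  by ring.
- by move=> x y; rewrite !aE J9 J10; ring.
- by move=> y; rewrite aE (sym9 xi) (sym10 xi) xixi9 xixi10; ring.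
- by move=> x; rewrite aE xixi9 xixi10; ring.
Qed.

Lemma C9_C10_bilinear alpha : in_C9_C10 J xi eta alpha ->
  exists B : 'M[R]_n, forall x y, alpha x y xi = inner B x y.
Proof.
move=> [a9 [a10 [[[[l9 m9 _] _] _] [[[l10 m10 _] _] _] aE]]].
apply: bilinear_inner => [y k u v|x k u v]; rewrite !aE.
  by rewrite l9 l10 /=; ring.
by rewrite m9 m10 /=; ring.
Qed.

End ChineaGonzalez.

(** * Covariant derivatives of the structure tensors in a chart *)

Section AlmostContactManifold.
Context {R : realType} {n : nat} {M : smooth_manifold R n}.
Variables (phi : endo_field M) (xi : vector_field M) (eta : one_form M)
  (g : riemannian_metric M) (i : chart_index M).
Hypothesis acm : almost_contact_metric phi xi eta g.
Hypothesis class : class_C9_C10 phi xi eta g.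
Local Notation V := 'rV[R]_n.
Local Notation U := (@chart_img R n M i).
Local Notation G := (g i).
Local Notation Gamma := (christoffel (g i)).
Local Notation alpha := (nabla_Phi (g i) (phi i)).
Local Notation b x u v := (nabla_Phi (g i) (phi i) x u v (xi i x)).
Let Uo : open U. Proof. exact: chart_img_open. Qed.
Let Gdiff := fun y a b (Uy : U y) => christoffel_diff g a b Uy.
Implicit Types (x u v w z : V).

Local Notation H := (fun y => G y *m (phi i y)^T).
Local Notation cov := (covariant_derivative Gamma).

Lemma fundamental_C2 : entries_C2 U H.
Proof.
apply: entries_C2_mul => //; first exact: metric_C2.
by apply: entries_C2_tr => a b; apply: C2_on_coord => //; exact: ef_smooth.
Qed.

Lemma reeb_diff x : U x -> entries_diff (xi i) x.
Proof.
by move=> Ux a b; have [+ _] := C2_on_coord a b Uo (vf_smooth xi i); exact.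
Qed.

Lemma eta_xi_chart x : U x -> pairing (eta i x) (xi i x) = 1.
Proof. by move=> Ux; exact: (acm_eta_xi acm Ux). Qed.

Lemma xi_phi x : U x -> xi i x *m phi i x = 0.
Proof. by move=> Ux; exact: (xi_J (acm_phi2 acm Ux) (acm_eta_xi acm Ux)). Qed.

Lemma eta_inner x u : U x -> pairing (eta i x) u = inner (G x) u (xi i x).
Proof.
move=> Ux; apply: esym.
exact: (inner_xi (acm_phi2 acm Ux) (acm_eta_xi acm Ux) (acm_compat acm Ux)).
Qed.

Lemma phi_skew x u v : U x ->
  inner (G x) u (v *m phi i x) = - inner (G x) (u *m phi i x) v.
Proof.
move=> Ux.
exact: (inner_skewJ (acm_phi2 acm Ux) (acm_eta_xi acm Ux) (acm_compat acm Ux)).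
Qed.

Lemma fundamentalE x u v : 
  inner (G x *m (phi i x)^T) u v = inner (G x) u (v *m phi i x).
Proof. by rewrite -innerMr. Qed.

Lemma class_form x : U x ->
  [/\ forall u z w, alpha x u z w
        = pairing (eta i x) w * b x u z - pairing (eta i x) z * b x u w,
      forall u v, b x (u *m phi i x) (v *m phi i x) = - b x u v,
      forall v, b x (xi i x) v = 0 &
      forall u, b x u (xi i x) = 0].
Proof.
by move=> Ux; exact: (C9_C10_form (eta_xi_chart Ux) (xi_phi Ux) (class Ux)).
Qed.

Definition nabla_reeb x u := 'D_u (xi i) x + Gamma x u (xi i x).

Definition nabla_eta x u w :=
  'D_u (fun y => pairing (eta i y) w) x - pairing (eta i x) (Gamma x u w).

Lemma nabla_reeb_eta x u w : U x ->
  nabla_eta x u w = inner (G x) w (nabla_reeb x u).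
Proof.
move=> Ux; rewrite /nabla_eta.
have -> : 'D_u (fun y => pairing (eta i y) w) x =
          'D_u (fun y => inner (G y) w (xi i y)) x.
  by apply: near_eq_derive; apply: open_near Uo Ux _ => y Uy; exact: eta_inner.
rewrite (derive_innerr u w (entries_C2_diff (metric_C2 g i) Ux) (reeb_diff Ux)).
rewrite (metric_compat g w (xi i x) u Ux) (eta_inner _ Ux) /nabla_reeb innerDr.
by ring.
Qed.

(** Differentiate g(xi, xi) = 1. *)
Lemma nabla_reeb_xi x u : U x -> inner (G x) (nabla_reeb x u) (xi i x) = 0.
Proof.
move=> Ux; have dG := entries_C2_diff (metric_C2 g i) Ux.
have D1 : 'D_u (fun y => inner (G y) (xi i y) (xi i y)) x = 0.
  rewrite -(derive_cst (1 : R) x u); apply: near_eq_derive.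
  apply: open_near Uo Ux _ => y Uy.
  by rewrite -(eta_inner _ Uy) (eta_xi_chart Uy).
move: D1; rewrite (derive_inner u dG (reeb_diff Ux) (reeb_diff Ux)).
rewrite (metric_compat g (xi i x) (xi i x) u Ux).
rewrite (riemannian_inner_sym g (xi i x) ('D_u (xi i) x) Ux).
rewrite (riemannian_inner_sym g (xi i x) (Gamma x u (xi i x)) Ux).
rewrite /nabla_reeb innerDl.
by move: (inner _ _ _) (inner _ _ _) => p q; lra.
Qed.

(** Differentiate Phi(z, xi) = 0 and move phi across the metric by skewness. *)
Lemma form_nabla_reeb x u z : U x ->
  b x u z = inner (G x) (z *m phi i x) (nabla_reeb x u).
Proof.
move=> Ux; rewrite nabla_PhiE /covariant_derivative.
have D0 : 'D_u (fun y => inner (H y) z (xi i y)) x = 0.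
  rewrite -(derive_cst (0 : R) x u); apply: near_eq_derive.
  apply: open_near Uo Ux _ => y Uy.
  by rewrite fundamentalE (xi_phi Uy) inner0r.
move: D0.
rewrite (derive_innerr u z (entries_C2_diff fundamental_C2 Ux) (reeb_diff Ux)).
rewrite !fundamentalE (xi_phi Ux) inner0r.
rewrite (phi_skew z _ Ux) (phi_skew z (Gamma x u (xi i x)) Ux).
move/eqP; rewrite subr_eq0 => /eqP ->.
by rewrite /nabla_reeb innerDr subr0 opprK.
Qed.

Lemma form_nabla_eta x u w : U x -> nabla_eta x u w = - b x u (w *m phi i x).
Proof.
move=> Ux; rewrite (form_nabla_reeb _ _ Ux) (acm_phi2 acm Ux) (nabla_reeb_eta _ _ Ux).
rewrite innerDl innerNl innerZl (riemannian_inner_sym g (xi i x) (nabla_reeb x u) Ux).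
by rewrite (nabla_reeb_xi _ Ux) mulr0 addr0 opprK.
Qed.

Lemma form_diff x u z : U x -> differentiable (fun y => b y u z) x.
Proof.
move=> Ux.
apply: (@near_eq_differentiable _ _
   (fun y => \sum_k xi i y 0 k * cov H y u z (delta_mx 0 k))).
  apply: open_near Uo Ux _ => y Uy; rewrite [in RHS](row_sum_delta (xi i y)).
  (* Membership in the class provides linearity in the last argument, so the moving vector xi can be
     expanded in the constant basis. *)
  have [a9 [a10 [[[[_ _ r9] _] _] [[[_ _ r10] _] _] aE]]] := class Uy.
  have lin : scalar (alpha y u z).
    by move=> k v w; rewrite !aE r9 r10 /=; ring.
  pose f : {linear V -> R^o} :=
    HB.pack (alpha y u z) (GRing.isLinear.Build _ _ _ _ (alpha y u z) lin).
  rewrite -[RHS]/(f _) linear_sum; apply: eq_bigr => k _.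
  by rewrite linearZ /= nabla_PhiE.
apply: differentiable_bigsum => k; apply: differentiableM.
  exact: reeb_diff.
exact: (differentiable_cov Uo Gdiff u z _ fundamental_C2 Ux).
Qed.

Lemma eta_diff x w : U x -> differentiable (fun y => pairing (eta i y) w) x.
Proof.
move=> Ux.
apply: (@near_eq_differentiable _ _ (fun y => inner (G y) w (xi i y))).
  by apply: open_near Uo Ux _ => y Uy; rewrite eta_inner.
apply: differentiable_inner_entries.
- exact: entries_C2_diff (metric_C2 g i) Ux.
- exact: entries_diff_cst.
- exact: reeb_diff.
Qed.

(** Differentiating the expression of nabla Phi through eta and b, the derivatives of b are
    multiplied by eta(z) or eta(w), which vanish at [x]. *)
Lemma derive_class_form x u v z w : U x ->
  pairing (eta i x) z = 0 -> pairing (eta i x) w = 0 ->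
  'D_u (fun y => cov H y v z w) x =
  'D_u (fun y => pairing (eta i y) w) x * b x v z
  - 'D_u (fun y => pairing (eta i y) z) x * b x v w.
Proof.
move=> Ux ez ew.
have -> : 'D_u (fun y => cov H y v z w) x =
    'D_u ((fun y => pairing (eta i y) w) * (fun y => b y v z)
          - (fun y => pairing (eta i y) z) * (fun y => b y v w)) x.
  apply: near_eq_derive; apply: open_near Uo Ux _ => y Uy.
  by rewrite -nabla_PhiE; have [-> _ _ _] := class_form Uy.
have de a := diff_derivable (v := u) (eta_diff a Ux).
have db a := diff_derivable (v := u) (form_diff v a Ux).
rewrite (deriveB (derivableM (de w) (db z)) (derivableM (de z) (db w))).
rewrite (deriveM (de w) (db z)) (deriveM (de z) (db w)) ez ew !scale0r !add0r.
by congr (_ - _); exact: mulrC.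
Qed.

Lemma cov_formr x u z w : U x -> pairing (eta i x) w = 0 ->
  cov H x u z w = - (pairing (eta i x) z * b x u w).
Proof.
move=> Ux ew; rewrite -nabla_PhiE; have [-> _ _ _] := class_form Ux.
by rewrite ew mul0r add0r.
Qed.

Lemma cov_forml x u z w : U x -> pairing (eta i x) z = 0 ->
  cov H x u z w = pairing (eta i x) w * b x u z.
Proof.
move=> Ux ez; rewrite -nabla_PhiE; have [-> _ _ _] := class_form Ux.
by rewrite ez mul0r subr0.
Qed.

Lemma curvature_fundamental_form x u v z w : U x ->
  pairing (eta i x) z = 0 -> pairing (eta i x) w = 0 ->
  inner (G x) (curv G x u v z) (w *m phi i x)
  - inner (G x) (curv G x u v w) (z *m phi i x) =
  - (nabla_eta x u w * b x v z - nabla_eta x u z * b x v w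
     - nabla_eta x v w * b x u z + nabla_eta x v z * b x u w).
Proof.
move=> Ux ez ew.
have ricci := ricci_identity Uo Gdiff u v z w fundamental_C2 Ux.
have du := derive_class_form u v Ux ez ew.
have dv := derive_class_form v u Ux ez ew.
have eq := etrans (esym ricci) (congr2 (fun p q : R => p - q) du dv).
have kz : inner (G x *m (phi i x)^T) (curvature_of_connection Gamma x u v z) w =
    inner (G x) (curv G x u v z) (w *m phi i x).
  by rewrite fundamentalE curvE.
have kw : inner (G x *m (phi i x)^T) z (curvature_of_connection Gamma x u v w) =
    - inner (G x) (curv G x u v w) (z *m phi i x).
  rewrite fundamentalE (phi_skew z _ Ux); congr (- _).
  by rewrite -curvE; exact: riemannian_inner_sym.
(* The terms [puz], ..., [pvw], eta evaluated on Christoffel vectors, complete the plain derivatives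
   [duw], ..., [dvz] of eta to the covariant ones [nuw], ..., [nvz]. *)
have algebra (c1 c2 c3 c4 k1 k2 duw duz dvw dvz bvz bvw buz buw puz puw pvz pvw
    l1 l2 nuw nuz nvw nvz : R) :
  c1 + c2 - c3 - c4 - k1 - k2
    = (duw * bvz - duz * bvw) - (dvw * buz - dvz * buw) ->
  c1 = - (puz * bvw) -> c2 = puw * bvz -> c3 = - (pvz * buw) -> c4 = pvw * buz ->
  k1 = l1 -> k2 = - l2 ->
  nuw = duw - puw -> nuz = duz - puz -> nvw = dvw - pvw -> nvz = dvz - pvz ->
  l1 - l2 = - (nuw * bvz - nuz * bvw - nvw * buz + nvz * buw).
  move=> e h1 h2 h3 h4 h5 h6 h7 h8 h9 h10.
  have -> : l1 - l2 = c1 + c2 - c3 - c4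
      - (duw * bvz - duz * bvw - (dvw * buz - dvz * buw)).
    by rewrite -e h5 h6; ring.
  by rewrite h1 h2 h3 h4 h7 h8 h9 h10; ring.
exact: (algebra _ _ _ _ _ _ _ _ _ _ _ _ _ _ _ _ _ _ _ _ _ _ _ _ eq
  (cov_formr v (Gamma x u z) Ux ew) (cov_forml v (Gamma x u w) Ux ez)
  (cov_formr u (Gamma x v z) Ux ew) (cov_forml u (Gamma x v w) Ux ez)
  kz kw erefl erefl erefl erefl).
Qed.

End AlmostContactManifold.

(** * Contact manifolds *)

Section ContactPoint.
Context {R : realType} {m : nat} {M : smooth_manifold R m.*2.+1}.
Variables (phi : endo_field M) (xi : vector_field M) (eta : one_form M)
  (g : riemannian_metric M) (i : chart_index M) (x : 'rV[R]_m.*2.+1).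
Hypothesis acm : almost_contact_metric phi xi eta g.
Hypothesis class : class_C9_C10 phi xi eta g.
Hypothesis contact : contact_form eta.
Hypothesis Ux : chart_img i x.
Local Notation V := 'rV[R]_m.*2.+1.
Local Notation G := (g i x).
Local Notation J := (phi i x).
Local Notation b u v := (nabla_Phi (g i) (phi i) x u v (xi i x)).
Implicit Types (u v w z : V).

Lemma class_matrix : exists B : 'M[R]_m.*2.+1,
  [/\ forall u v, b u v = inner B u v,
      forall u v, inner B (u *m J) (v *m J) = - inner B u v,
      forall v, inner B (xi i x) v = 0 &
      forall u, inner B u (xi i x) = 0].
Proof.
have [B bB] := C9_C10_bilinear (class Ux); exists B.
have [_ bJ b_xil b_xir] := class_form acm class Ux.
by split=> // *; rewrite -!bB.
Qed.

(** The connection being symmetric, d eta is the skew part of nabla eta; [form_nabla_eta] and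
    [form_J] then bring in [B] and its transpose. *)
Lemma ext_d_skew (B : 'M[R]_m.*2.+1) u v : (forall u v, b u v = inner B u v) ->
  ext_d (eta i) x u v = - inner (B - B^T) u (v *m J).
Proof.
move=> bB; have [_ bJ _ b_xir] := class_form acm class Ux.
have bJB a c : inner B (a *m J) (c *m J) = - inner B a c by rewrite -!bB.
have b_xirB a : inner B a (xi i x) = 0 by rewrite -bB.
have dE : ext_d (eta i) x u v = nabla_eta eta g i x u v - nabla_eta eta g i x v u.
  rewrite /ext_d /ext_d_field bracket_cst /nabla_eta (christoffel_sym g u v Ux).
  by rewrite [pairing _ (cst 0 x)]/pairing mul0mx mxE subr0 opprB addrA subrK.
rewrite dE (form_nabla_eta acm u v Ux) (form_nabla_eta acm v u Ux) !bB.
rewrite inner_skew (form_J (acm_phi2 acm Ux) bJB b_xirB v u).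
by ring.
Qed.

Lemma contact_nondegenerate (B : 'M[R]_m.*2.+1) u :
  (forall u v, b u v = inner B u v) -> pairing (eta i x) u = 0 ->
  (forall v, inner (B - B^T) u (v *m J) = 0) -> u = 0.
Proof.
move=> bB eu Bu; have [w] := contact Ux.
have dB a c := ext_d_skew a c bB.
have dC a c : ext_d (eta i) x a c = - ext_d (eta i) x c a.
  rewrite /ext_d /ext_d_field !bracket_cst [pairing _ (cst 0 x)]/pairing mul0mx mxE.
  by rewrite !subr0 opprB.
move/contact_kernel; apply => //.
- by move=> v k a c; rewrite !dB innerDl innerZl; ring.
- move=> v k a c; rewrite !dB mulmxDl -scalemxAl innerDr innerZr; ring.
- by move=> v; rewrite dB Bu oppr0.
- by move=> v; rewrite dC dB Bu !oppr0.
Qed.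

Lemma contact_dim_dvd4 : (4 %| m.*2)%N.
Proof.
have [B [bB bJ b_xil b_xir]] := class_matrix.
apply: (skew_rank_dvd4 (acm_phi2 acm Ux) (acm_eta_xi acm Ux) bJ b_xil b_xir).
by move=> u; exact: contact_nondegenerate.
Qed.

Lemma constant_curvature_dim (c : R) : (0 < m)%N ->
  (forall u v, pairing (eta i x) u = 0 -> pairing (eta i x) v = 0 ->
     row_free (col_mx u v) -> sectional (g i) x u v = c) ->
  (m.*2 <= 4)%N.
Proof.
move=> m0 sec; have [B [bB bJ b_xil b_xir]] := class_matrix.
have nondeg u := contact_nondegenerate (u := u) bB.
(* Divisibility by 4 excludes dimension 3, so the curvature argument has room for its vector [y]. *)
have n3 : (3 < m.*2.+1)%N.
  by rewrite ltnS; apply: leq_trans (dvdn_leq _ contact_dim_dvd4); rewrite ?double_gt0.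
(* The orthogonal projection onto D along xi. *)
pose T u := u - pairing (eta i x) u *: xi i x.
have TD : {morph T : u v / u + v}.
  by move=> u v; rewrite /T pairingD scalerDl opprD addrACA.
have eT u : pairing (eta i x) (T u) = 0.
  by rewrite /T pairingD pairingN pairingZ (acm_eta_xi acm Ux) mulr1 subrr.
have TE u : pairing (eta i x) u = 0 -> T u = u by rewrite /T => ->; rewrite scale0r subr0.
have K := sectional_curvature_ker Ux TD (fun u v => sec _ _ (eT u) (eT v)).
rewrite -ltnS (leq_trans (skew_rank nondeg)) // ltnS.
apply: (skew_rank_le4 (rm_sym g Ux) (@rm_pos _ _ _ g _ _ Ux) (acm_phi2 acm Ux)
  (acm_eta_xi acm Ux) (acm_compat acm Ux) bJ b_xil b_xir n3 (c := c)).
move=> u v z w eu ev ez ew.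
have eJ a : pairing (eta i x) (a *m J) = 0.
  exact: (eta_J (acm_phi2 acm Ux) (acm_eta_xi acm Ux)).
have := K u v z (w *m J); rewrite !TE // => <-.
have := K u v w (z *m J); rewrite !TE // => <-.
rewrite (curvature_fundamental_form acm class u v Ux ez ew).
rewrite (form_nabla_eta acm u w Ux) (form_nabla_eta acm u z Ux).
rewrite (form_nabla_eta acm v w Ux) (form_nabla_eta acm v z Ux) !bB.
by ring.
Qed.

End ContactPoint.

Theorem theorem2 (R : realType) (m : nat) (M : smooth_manifold R m.*2.+1)
    (phi : endo_field M) (xi : vector_field M) (eta : one_form M)
    (g : riemannian_metric M)
    (hdim : (3 <= m.*2.+1)%N)
    (hcontact : contact_form eta)
    (hacm : almost_contact_metric phi xi eta g)
    (hclass : class_C9_C10 phi xi eta g) :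
  (exists k : nat, (1 <= k)%N /\ m.*2.+1 = (4 * k + 1)%N) /\
  ((exists (p : M) (c : R), constant_curvature_on_ker eta g p c) ->
   m.*2.+1 = 5%N).
Proof.
have m0 : (0 < m)%N by rewrite -double_gt0 -ltnS ltnW.
have [p0 _] := mfd_nonempty M; have [i0 p0i] := chart_cover p0.
have U0 : chart_img i0 (chart i0 p0) by exists p0.
have dvd4 := contact_dim_dvd4 hacm hclass hcontact U0.
split.
  exists (m.*2 %/ 4)%N; rewrite divn_gt0 // dvdn_leq ?double_gt0 //.
  by rewrite mulnC divnK // addn1.
move=> [p [c cc]]; have [i pi] := chart_cover p.
have Up : chart_img i (chart i p) by exists p.
have le4 := constant_curvature_dim hacm hclass hcontact Up m0 (cc i pi).
(* The even number [m.*2] is a positive multiple of 4 and at most 4. *)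
congr S; apply/eqP; rewrite eqn_leq le4.
by apply: dvdn_leq => //; rewrite double_gt0.
Qed.
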